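(* Let $\xi(j)$, $j\in\mathbb Z$, be a zero mean wide sense stationary sequence with spectral density $f(\lambda)$ satisfying the minimality condition $\int_{-\pi}^\pi f^{-1}(\lambda)d\lambda<\infty$. Let $N\ge0$, $\vec{\mathbf a}_N=(a(0),\dots,a(N))\in\mathbb C^{N+1}$, let $r_m=\frac1{2\pi}\int_{-\pi}^\pi f^{-1}(\lambda)e^{-im\lambda}d\lambda$, and let $B_N=(r_{k-j})_{k,j=0}^N$. Then the spectral characteristic of the optimal linear estimate $\hat A_N\xi$ of $A_N\xi=\sum_{j=0}^Na(j)\xi(j)$ based on observations of $\xi(j)$ at $j\in\mathbb Z\setminus\{0,1,\dots,N\}$ is $$h(e^{i\lambda})=\sum_{j=0}^Na(j)e^{ij\lambda}-\left(\sum_{j=0}^N(B_N^{-1}\vec{\mathbf a}_N)_je^{ij\lambda}\right)\left(\sum_{m=-\infty}^\infty r_me^{im\lambda}\right),$$ where $\sum_mr_me^{im\lambda}$ is the Fourier series of (and stands for) $f^{-1}(\lambda)$, and the mean square error is $$\Delta(h;f)=E|A_N\xi-\hat A_N\xi|^2=\langle B_N^{-1}\vec{\mathbf a}_N,\vec{\mathbf a}_N\rangle .$$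
   Context: $E\xi(j+k)\overline{\xi(j)}=\frac1{2\pi}\int_{-\pi}^\pi e^{ik\lambda}f(\lambda)d\lambda$; $\xi(j)=\int_{-\pi}^\pi e^{ij\lambda}Z(d\lambda)$ with $Z$ an orthogonal stochastic measure. $\langle x,y\rangle=\sum_{k=0}^Nx_k\overline{y_k}$. $L_2^N(f)$ is the closed subspace of $L_2(f)$ generated by $\{e^{ij\lambda}:j\in\mathbb Z\setminus\{0,\dots,N\}\}$. A linear estimate has the form $\hat A_N\xi=\int_{-\pi}^\pi h(e^{i\lambda})Z(d\lambda)$ with spectral characteristic $h\in L_2^N(f)$ and error $\Delta(h;f)=\frac1{2\pi}\int_{-\pi}^\pi\left|\sum_{j=0}^Na(j)e^{ij\lambda}-h(e^{i\lambda})\right|^2f(\lambda)d\lambda$; the optimal one minimizes this error. *)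

(* Defs.v *)
From HB Require Import structures.
From mathcomp Require Import all_boot all_order all_algebra.
From mathcomp Require Import complex.
From mathcomp Require Import all_classical all_reals all_analysis.

Set Implicit Arguments.
Unset Strict Implicit.
Unset Printing Implicit Defensive.

Import Order.TTheory GRing.Theory Num.Theory.
Import numFieldNormedType.Exports.

Local Open Scope classical_set_scope.
Local Open Scope complex_scope.
Local Open Scope ring_scope.

Definition sqnormc (R : realType) (z : R[i]) : R := Normc.normc z ^+ 2.

Definition cmeasurable_fun d (T : measurableType d) (R : realType)
    (D : set T) (g : T -> R[i]) : Prop :=
  measurable_fun D (fun x => complex.Re (g x)) /\
  measurable_fun D (fun x => complex.Im (g x)).

(* Meaningful when the real and imaginary parts of g are integrable on D: the
   library's Rintegral sends infinite integrals to 0. *)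
Definition cintegral d (T : measurableType d) (R : realType)
    (mu : {measure set T -> \bar R}) (D : set T) (g : T -> R[i]) : R[i] :=
  (\int[mu]_(x in D) complex.Re (g x)) +i* (\int[mu]_(x in D) complex.Im (g x)).

Definition cexpectation d (T : measurableType d) (R : realType)
    (P : probability T R) (X : T -> R[i]) : R[i] := cintegral P [set: T] X.

(* E|X|^2, valued in [0, +oo] *)
Definition mean_square d (T : measurableType d) (R : realType)
    (P : probability T R) (X : T -> R[i]) : \bar R :=
  'E_P[fun w => sqnormc (X w)]%E.

Definition square_integrable d (T : measurableType d) (R : realType)
    (P : probability T R) (X : T -> R[i]) : Prop :=
  cmeasurable_fun [set: T] X /\ (mean_square P X < +oo)%E.

(* Functions of e^{i lambda} are represented as functions of lambda in
   [-pi, pi]. *)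
Definition freq (R : realType) : set R := `[- pi, pi].

Definition expi (R : realType) (x : R) : R[i] := cos x +i* sin x.

Definition expij (R : realType) (j : int) (x : R) : R[i] := expi (j%:~R * x).

Definition spec_integral (R : realType) (g : R -> R[i]) : R[i] :=
  ((2 * pi)^-1)%:C * cintegral (@lebesgue_measure R) (@freq R) g.

(* Squared norm in L_2(f), with the normalization 1/(2 pi), valued in
   [0, +oo]. *)
Definition sqnorm_f (R : realType) (f : R -> R) (g : R -> R[i]) : \bar R :=
  (((2 * pi)^-1)%:E *
     \int[@lebesgue_measure R]_(x in @freq R) (sqnormc (g x) * f x)%:E)%E.

Definition L2 (R : realType) (f : R -> R) (g : R -> R[i]) : Prop :=
  cmeasurable_fun (@freq R) g /\ (sqnorm_f f g < +oo)%E.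

Definition is_density (R : realType) (f : R -> R) : Prop :=
  (forall x, @freq R x -> 0 <= f x) /\
  (@lebesgue_measure R).-integrable (@freq R) (EFin \o f).

(* The inverse is the one of \bar R, for which 0^-1 = +oo; in particular
   minimality forces f > 0 almost everywhere on [-pi, pi]. *)
Definition minimal (R : realType) (f : R -> R) : Prop :=
  (\int[@lebesgue_measure R]_(x in @freq R) ((f x)%:E^-1) < +oo)%E.

Definition wide_sense_stationary d (T : measurableType d) (R : realType)
    (P : probability T R) (xi : int -> T -> R[i]) : Prop :=
  [/\ forall j, square_integrable P (xi j),
      forall j, cexpectation P (xi j) = 0 &
      forall j k, cexpectation P (fun w => xi (j + k) w * (xi j w)^*) =
                  cexpectation P (fun w => xi k w * (xi 0 w)^*)].

Definition has_spectral_density d (T : measurableType d) (R : realType)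
    (P : probability T R) (xi : int -> T -> R[i]) (f : R -> R) : Prop :=
  is_density f /\
  forall j k, cexpectation P (fun w => xi (j + k) w * (xi j w)^*) =
              spec_integral (fun x => expij k x * (f x)%:C).

(* Only the values Z A on measurable subsets A of [-pi, pi] matter. *)
Definition orthogonal_stochastic_measure d (T : measurableType d)
    (R : realType) (P : probability T R) (f : R -> R)
    (Z : set R -> T -> R[i]) : Prop :=
  [/\ forall A, measurable A -> A `<=` @freq R -> square_integrable P (Z A),
      forall A : (set R)^nat,
        (forall n, measurable (A n) /\ A n `<=` @freq R) ->
        trivIset [set: nat] A ->
        mean_square P (fun w => Z (\bigcup_n A n) w - \sum_(i < n) Z (A i) w)
          @[n --> \oo] --> 0%E &
      forall A B, measurable A -> A `<=` @freq R ->
        measurable B -> B `<=` @freq R ->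
        cexpectation P (fun w => Z A w * (Z B w)^*) =
        spec_integral (fun x => (\1_(A `&` B) x * f x)%:C)].

(* Y = \int g dZ (P-almost surely): the integral of a simple function
   \sum_l c_l 1_{A_l} is \sum_l c_l Z(A_l), extended to L_2(f) by taking
   mean square limits. *)
Definition is_stochastic_integral d (T : measurableType d)
    (R : realType) (P : probability T R) (f : R -> R)
    (Z : set R -> T -> R[i]) (g : R -> R[i]) (Y : T -> R[i]) : Prop :=
  [/\ L2 f g, square_integrable P Y &
      forall e : R, 0 < e ->
        exists n (c : 'I_n -> R[i]) (A : 'I_n -> set R),
          [/\ forall l, measurable (A l) /\ A l `<=` @freq R,
              (sqnorm_f f (fun x => g x - \sum_(l < n) c l * (\1_(A l) x)%:C)%R
                 < e%:E)%E &
              (mean_square P (fun w => Y w - \sum_(l < n) c l * Z (A l) w)%R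
                 < e%:E)%E]].

Definition observed (N : nat) (j : int) : bool := ~~ ((0 <= j) && (j <= N%:Z)).

(* L_2^N(f): the closure in L_2(f) of the span of the observed harmonics. *)
Definition L2N (R : realType) (N : nat) (f : R -> R) (g : R -> R[i]) : Prop :=
  L2 f g /\
  forall e : R, 0 < e ->
    exists n (c : 'I_n -> R[i]) (j : 'I_n -> int),
      (forall l, observed N (j l)) /\
      (sqnorm_f f (fun x => g x - \sum_(l < n) c l * expij (j l) x)%R
         < e%:E)%E.

Definition trig_poly (R : realType) (N : nat) (a : 'cV[R[i]]_N.+1) (x : R) :
  R[i] := \sum_(j < N.+1) a j 0 * expij (j : nat)%:Z x.

Definition linear_functional T (R : realType) (N : nat) (a : 'cV[R[i]]_N.+1)
    (xi : int -> T -> R[i]) (w : T) : R[i] :=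
  \sum_(j < N.+1) a j 0 * xi (j : nat)%:Z w.

Definition Delta (R : realType) (N : nat) (a : 'cV[R[i]]_N.+1) (f : R -> R)
    (h : R -> R[i]) : \bar R :=
  sqnorm_f f (fun x => trig_poly a x - h x).

Definition optimal_characteristic (R : realType) (N : nat)
    (a : 'cV[R[i]]_N.+1) (f : R -> R) (h : R -> R[i]) : Prop :=
  L2N N f h /\ forall g, L2N N f g -> (Delta a f h <= Delta a f g)%E.

Definition fourier_inv (R : realType) (f : R -> R) (m : int) : R[i] :=
  spec_integral (fun x => ((f x)^-1)%:C * expij (- m) x).

Definition BN (R : realType) (N : nat) (f : R -> R) : 'M[R[i]]_N.+1 :=
  \matrix_(k < N.+1, j < N.+1) fourier_inv f ((k : nat)%:Z - (j : nat)%:Z).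

Definition inner (R : realType) (N : nat) (x y : 'cV[R[i]]_N.+1) : R[i] :=
  \sum_(k < N.+1) x k 0 * (y k 0)^*.

(* The Fourier series \sum_m r_m e^{i m lambda} stands for 1/f: it need not
   converge pointwise, 1/f being only integrable.  Here 1/f is the inverse of
   R, with 0^-1 = 0; it differs from the one in [minimal] on the zero set of f,
   which is negligible under minimality. *)
Definition h_opt (R : realType) (N : nat) (a : 'cV[R[i]]_N.+1) (f : R -> R)
    (x : R) : R[i] :=
  trig_poly a x - trig_poly (invmx (BN N f) *m a) x * ((f x)^-1)%:C.

(* Main.v *)
(** Put psi_k = e^(i k x) / f, an element of L_2(f) by minimality.  For the inner
product of L_2(f) with its 1/(2 pi), <e^(i j x), psi_k> is the Kronecker delta
and <psi_j, psi_k> = r_(k-j), so B_N is the Gram matrix of psi_0, ..., psi_N; it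
is invertible because the psi_k have a biorthogonal system.  Trigonometric
polynomials are dense in L_2(f), and g |-> g - sum_k <g, psi_k> e^(i k x) is
continuous and maps them onto the span of the observed harmonics; hence L_2^N(f)
is the orthogonal complement of psi_0, ..., psi_N.  With B_N c = a, the function
h = sum_j a_j e^(i j x) - sum_j c_j psi_j is orthogonal to all psi_k while its
error sum_j c_j psi_j lies in their span, so it is the orthogonal projection by
Pythagoras, and its squared error is c^* B_N c = <c, a>.  The stochastic
integral is an isometry of L_2(f) into L_2(P), defined everywhere by
Riesz-Fischer, which carries the error over to the estimate.

Density: for y = (1 - sin ((x - a) / 2) cos (x / 2)) / 2 the trigonometric
polynomials (1 - y^n)^(2^n) stay in [0, 1] and converge almost everywhere on
[-pi, pi] to the indicator of ]a, pi]; a pi-lambda argument gives all measurable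
sets. *)

Require Import Defs.
From HB Require Import structures.
From mathcomp Require Import all_boot all_order all_algebra.
From mathcomp Require Import complex ring lra.
From mathcomp Require Import all_classical all_reals all_analysis.
From mathcomp Require Import measurable_realfun.

Set Implicit Arguments.
Unset Strict Implicit.
Unset Printing Implicit Defensive.

Import Order.TTheory GRing.Theory Num.Theory.
Import numFieldNormedType.Exports.

Local Open Scope classical_set_scope.
Local Open Scope complex_scope.
Local Open Scope ring_scope.

(** Functions are not identified almost everywhere and no square root of a norm is taken: everything
    is phrased with the squared seminorm [wnorm], valued in the extended reals, for a measure with a
    real weight. The weight f / (2 pi) gives L_2(f) and the weight 1 gives L_2(P), so both sides of
    the stochastic integral share one calculus. The triangle inequality and Cauchy-Schwarz are
    replaced by |z + u|^2 <= (1 + t) |z|^2 + (1 + 1/t) |u|^2 and its analogue for products: a fixed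
    t is enough for closures and continuity, while t -> 0 recovers equality of norms. Since f may be
    unbounded and 1/f is only integrable, approximation goes through dominated convergence:
    indicators and their approximants stay in [0, 1], and the weight itself, of finite mass, is the
    majorant. *)

(** * Complex-valued integrals *)

Section complex_algebra.
Context {R : realType}.
Implicit Types z u : R[i].

Lemma sqnormcE z : sqnormc z = complex.Re z ^+ 2 + complex.Im z ^+ 2.
Proof. by case: z => a b; rewrite /sqnormc /= sqr_sqrtr// addr_ge0 ?sqr_ge0. Qed.

Lemma sqnormc_ge0 z : 0 <= sqnormc z.
Proof. exact: sqr_ge0. Qed.

Lemma sqnormc0_eq0 z : sqnormc z = 0 -> z = 0.
Proof.
case: z => a b; rewrite sqnormcE /= => /eqP.
by rewrite paddr_eq0 ?sqr_ge0// !sqrf_eq0 => /andP[/eqP-> /eqP->].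
Qed.

Lemma sqnormcM z u : sqnormc (z * u) = sqnormc z * sqnormc u.
Proof. by case: z => a b; case: u => c e; rewrite !sqnormcE /=; ring. Qed.

Lemma sqnormcN z : sqnormc (- z) = sqnormc z.
Proof. by case: z => a b; rewrite !sqnormcE /=; ring. Qed.

Lemma real_cM (x y : R) : (x * y)%:C = x%:C * y%:C.
Proof. exact: rmorphM. Qed.

Lemma real_cX (x : R) n : (x ^+ n)%:C = x%:C ^+ n.
Proof. exact: rmorphXn. Qed.

Lemma real_cB (x y : R) : (x - y)%:C = x%:C - y%:C.
Proof. exact: rmorphB. Qed.

Lemma sqnormc_real (x : R) : sqnormc x%:C = x ^+ 2.
Proof. by rewrite sqnormcE /=; ring. Qed.

Lemma mulc_conj z : z * z^* = (sqnormc z)%:C.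
Proof.
by case: z => a b; apply/eqP; rewrite sqnormcE eq_complex /=; apply/andP; split;
  apply/eqP; ring.
Qed.

(** In each coordinate, expanding t^-1 (t a - b)^2 >= 0 gives 2 a b <= t a^2 + t^-1 b^2. *)
Lemma sqnormcD_le (t : R) z u : 0 < t ->
  sqnormc (z + u) <= (1 + t) * sqnormc z + (1 + t^-1) * sqnormc u.
Proof.
move=> t0; have P (a b : R) : (a + b) ^+ 2 <= (1 + t) * a ^+ 2 + (1 + t^-1) * b ^+ 2.
  have : 0 <= t^-1 * (t * a - b) ^+ 2 by rewrite mulr_ge0 ?sqr_ge0 ?invr_ge0 ?ltW.
  rewrite (_ : t^-1 * _ = t^-1 * t * t * a ^+ 2 - (t^-1 * t *+ 2) * a * b
    + t^-1 * b ^+ 2); last ring.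
  by rewrite mulVf ?gt_eqF//; nra.
case: z => a b; case: u => c e; rewrite !sqnormcE /=.
by have := P a c; have := P b e; lra.
Qed.

Lemma cRe_sum (I : Type) (s : seq I) (F : I -> R[i]) :
  complex.Re (\sum_(i <- s) F i) = \sum_(i <- s) complex.Re (F i).
Proof. by apply: (big_morph (@complex.Re R)) => // -[? ?] [? ?]. Qed.

Lemma cIm_sum (I : Type) (s : seq I) (F : I -> R[i]) :
  complex.Im (\sum_(i <- s) F i) = \sum_(i <- s) complex.Im (F i).
Proof. by apply: (big_morph (@complex.Im R)) => // -[? ?] [? ?]. Qed.

Lemma complex_ext z u : complex.Re z = complex.Re u ->
  complex.Im z = complex.Im u -> z = u.
Proof. by case: z => a b; case: u => c e /= -> ->. Qed.

Lemma cReM z u : complex.Re (z * u) =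
  complex.Re z * complex.Re u - complex.Im z * complex.Im u.
Proof. by case: z => a b; case: u. Qed.

Lemma cImM z u : complex.Im (z * u) =
  complex.Re z * complex.Im u + complex.Im z * complex.Re u.
Proof. by case: z => a b; case: u => c e /=; rewrite addrC; ring. Qed.

Lemma cReD z u : complex.Re (z + u) = complex.Re z + complex.Re u.
Proof. by case: z => a b; case: u. Qed.

Lemma cImD z u : complex.Im (z + u) = complex.Im z + complex.Im u.
Proof. by case: z => a b; case: u. Qed.

Lemma cReN z : complex.Re (- z) = - complex.Re z.
Proof. by case: z. Qed.

Lemma cImN z : complex.Im (- z) = - complex.Im z.
Proof. by case: z. Qed.

Lemma cReC z : complex.Re z^* = complex.Re z.
Proof. by case: z. Qed.

Lemma cImC z : complex.Im z^* = - complex.Im z.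
Proof. by case: z. Qed.

End complex_algebra.

Section complex_measurability.
Context d {T : measurableType d} {R : realType} (D : set T).
Implicit Types g h : T -> R[i].

Lemma cmeasurable_cst (c : R[i]) : cmeasurable_fun D (fun=> c).
Proof. by split; exact: measurable_cst. Qed.

Lemma cmeasurable_real (g : T -> R) : measurable_fun D g ->
  cmeasurable_fun D (fun x => (g x)%:C).
Proof. by move=> mg; split=> //=; exact: measurable_cst. Qed.

Lemma cmeasurableD g h : cmeasurable_fun D g -> cmeasurable_fun D h ->
  cmeasurable_fun D (fun x => g x + h x).
Proof.
move=> [g1 g2] [h1 h2]; split.
  by under eq_fun do rewrite cReD; exact: measurable_funD.
by under eq_fun do rewrite cImD; exact: measurable_funD.
Qed.

Lemma cmeasurableM g h : cmeasurable_fun D g -> cmeasurable_fun D h ->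
  cmeasurable_fun D (fun x => g x * h x).
Proof.
move=> [g1 g2] [h1 h2]; split.
  by under eq_fun do rewrite cReM; apply: measurable_funB; exact: measurable_funM.
by under eq_fun do rewrite cImM; apply: measurable_funD; exact: measurable_funM.
Qed.

Lemma cmeasurableZ c g : cmeasurable_fun D g ->
  cmeasurable_fun D (fun x => c * g x).
Proof. by move=> mg; apply: cmeasurableM => //; exact: cmeasurable_cst. Qed.

Lemma cmeasurableB g h : cmeasurable_fun D g -> cmeasurable_fun D h ->
  cmeasurable_fun D (fun x => g x - h x).
Proof.
move=> [g1 g2] [h1 h2]; split.
  by under eq_fun do rewrite cReD cReN; exact: measurable_funB.
by under eq_fun do rewrite cImD cImN; exact: measurable_funB.
Qed.

Lemma cmeasurable_conj g : cmeasurable_fun D g ->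
  cmeasurable_fun D (fun x => (g x)^*).
Proof.
move=> [g1 g2]; split; first by under eq_fun do rewrite cReC.
by under eq_fun do rewrite cImC; exact: measurable_funN.
Qed.

Lemma cmeasurable_sum (I : Type) (s : seq I) (F : I -> T -> R[i]) :
  (forall i, cmeasurable_fun D (F i)) ->
  cmeasurable_fun D (fun x => \sum_(i <- s) F i x).
Proof.
move=> mF; split.
  by under eq_fun do rewrite cRe_sum; apply: measurable_sum => i; case: (mF i).
by under eq_fun do rewrite cIm_sum; apply: measurable_sum => i; case: (mF i).
Qed.

Lemma measurable_sqnormc g : cmeasurable_fun D g ->
  measurable_fun D (fun x => sqnormc (g x)).
Proof.
move=> [g1 g2]; under eq_fun do rewrite sqnormcE.
by apply: measurable_funD; exact: measurable_funX.
Qed.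

Lemma eq_cmeasurable g h : (forall x, D x -> g x = h x) ->
  cmeasurable_fun D g -> cmeasurable_fun D h.
Proof.
move=> gh [g1 g2]; split.
  by apply: eq_measurable_fun g1 => x /[!inE] /gh ->.
by apply: eq_measurable_fun g2 => x /[!inE] /gh ->.
Qed.

End complex_measurability.

Section complex_integral.
Context d {T : measurableType d} {R : realType}.
Variables (mu : {measure set T -> \bar R}) (D : set T) (mD : measurable D).
Implicit Types g h : T -> R[i].

Definition cintegrable g :=
  mu.-integrable D (EFin \o (fun x => complex.Re (g x))) /\
  mu.-integrable D (EFin \o (fun x => complex.Im (g x))).

Lemma cintegrable_le g (b : T -> R) : cmeasurable_fun D g ->
  mu.-integrable D (EFin \o b) -> (forall x, D x -> sqnormc (g x) <= b x ^+ 2) ->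
  cintegrable g.
Proof.
move=> [g1 g2] ib gb; split; apply: le_integrable ib => //=.
- exact/measurable_EFinP.
- move=> x Dx; rewrite lee_fin -ler_sqr ?nnegrE// !real_normK ?num_real//.
  by apply: le_trans (gb x Dx); rewrite sqnormcE lerDl sqr_ge0.
- exact/measurable_EFinP.
- move=> x Dx; rewrite lee_fin -ler_sqr ?nnegrE// !real_normK ?num_real//.
  by apply: le_trans (gb x Dx); rewrite sqnormcE lerDr sqr_ge0.
Qed.

Lemma eq_cintegrable g h : (forall x, D x -> g x = h x) ->
  cintegrable g -> cintegrable h.
Proof.
move=> gh [g1 g2]; split.
  by apply: eq_integrable g1 => // x /[!inE] /gh /= ->.
by apply: eq_integrable g2 => // x /[!inE] /gh /= ->.
Qed.

Lemma eq_cintegral g h : (forall x, D x -> g x = h x) ->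
  cintegral mu D g = cintegral mu D h.
Proof.
by move=> gh; rewrite /cintegral; congr (_ +i* _); apply: eq_Rintegral => x;
  rewrite inE => /gh ->.
Qed.

Lemma cintegrableD g h : cintegrable g -> cintegrable h ->
  cintegrable (fun x => g x + h x).
Proof.
move=> [g1 g2] [h1 h2]; split.
  apply: eq_integrable (integrableD mD g1 h1) => // x _ /=.
  by rewrite cReD EFinD.
apply: eq_integrable (integrableD mD g2 h2) => // x _ /=.
by rewrite cImD EFinD.
Qed.

Lemma cintegralD g h : cintegrable g -> cintegrable h ->
  cintegral mu D (fun x => g x + h x) = cintegral mu D g + cintegral mu D h.
Proof.
move=> [g1 g2] [h1 h2]; apply: complex_ext; rewrite /= -RintegralD//;
  by apply: eq_Rintegral => x _; rewrite ?cReD ?cImD.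
Qed.

Lemma cintegrableZ c g : cintegrable g -> cintegrable (fun x => c * g x).
Proof.
move=> [g1 g2]; split.
  apply: eq_integrable (integrableB mD (integrableZl mD (complex.Re c) g1)
    (integrableZl mD (complex.Im c) g2)) => // x _ /=.
  by rewrite cReM EFinB !EFinM.
apply: eq_integrable (integrableD mD (integrableZl mD (complex.Re c) g2)
  (integrableZl mD (complex.Im c) g1)) => // x _ /=.
by rewrite cImM EFinD !EFinM.
Qed.

Lemma cintegralZ c g : cintegrable g ->
  cintegral mu D (fun x => c * g x) = c * cintegral mu D g.
Proof.
move=> [g1 g2].
have Z (r : R) (k : T -> R) : mu.-integrable D (EFin \o k) ->
  mu.-integrable D (EFin \o (fun x => r * k x)).
  by move=> ik; apply: eq_integrable (integrableZl mD r ik).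
apply: complex_ext; rewrite ?cReM ?cImM /=.
  rewrite -!RintegralZl// -RintegralB//; try exact: Z.
  by apply: eq_Rintegral => x _; rewrite cReM.
rewrite -!RintegralZl// -RintegralD//; try exact: Z.
by apply: eq_Rintegral => x _; rewrite cImM.
Qed.

Lemma cintegrable0 : cintegrable (fun=> 0).
Proof. by split; exact: integrable0. Qed.

Lemma cintegral0 : cintegral mu D (fun=> 0) = 0.
Proof.
by rewrite /cintegral /Rintegral integral0_eq.
Qed.

Lemma cintegrable_sum (I : Type) (s : seq I) (F : I -> T -> R[i]) :
  (forall i, cintegrable (F i)) -> cintegrable (fun x => \sum_(i <- s) F i x).
Proof.
move=> iF; elim: s => [|i s ih].
  by apply: eq_cintegrable cintegrable0 => x _; rewrite big_nil.
apply: eq_cintegrable (cintegrableD (iF i) ih) => x _.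
by rewrite big_cons.
Qed.

Lemma cintegral_sum (I : Type) (s : seq I) (F : I -> T -> R[i]) :
  (forall i, cintegrable (F i)) ->
  cintegral mu D (fun x => \sum_(i <- s) F i x) =
  \sum_(i <- s) cintegral mu D (F i).
Proof.
move=> iF; elim: s => [|i s ih].
  by rewrite big_nil -[RHS]cintegral0; apply: eq_cintegral => x _; rewrite big_nil.
rewrite big_cons -ih -cintegralD//; last exact: cintegrable_sum.
by apply: eq_cintegral => x _; rewrite big_cons.
Qed.

Lemma cintegral_conj g : cintegrable g ->
  cintegral mu D (fun x => (g x)^*) = (cintegral mu D g)^*.
Proof.
move=> [g1 g2]; rewrite /cintegral /=; congr (_ +i* _).
  by apply: eq_Rintegral => x _; rewrite cReC.
rewrite -[RHS]mulN1r -RintegralZl//; apply: eq_Rintegral => x _.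
by rewrite cImC mulN1r.
Qed.

Lemma cintegral_real (k : T -> R) :
  cintegral mu D (fun x => (k x)%:C) = (\int[mu]_(x in D) k x)%:C.
Proof. by rewrite /cintegral /= [X in _ +i* X]/Rintegral integral0_eq. Qed.

(** The real and imaginary parts are each dominated by b and estimated separately, which costs the
    factor 2. The bound on g is squared to avoid roots. *)
Lemma sqnormc_cintegral_le g (b : T -> R) : cintegrable g ->
  mu.-integrable D (EFin \o b) ->
  (forall x, D x -> 0 <= b x) -> (forall x, D x -> sqnormc (g x) <= b x ^+ 2) ->
  sqnormc (cintegral mu D g) <= 2 * (\int[mu]_(x in D) b x) ^+ 2.
Proof.
move=> [g1 g2] ib b0 gb.
have P (k : T -> R) : mu.-integrable D (EFin \o k) ->
    (forall x, D x -> k x ^+ 2 <= b x ^+ 2) ->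
    (\int[mu]_(x in D) k x) ^+ 2 <= (\int[mu]_(x in D) b x) ^+ 2.
  move=> ik kb; rewrite -[leLHS]real_normK ?num_real//.
  rewrite ler_sqr ?nnegrE ?Rintegral_ge0//.
  apply: le_trans (le_normr_Rintegral mD ik) _.
  apply: le_Rintegral => //; first exact: integrable_norm.
  by move=> x Dx; rewrite -ler_sqr ?nnegrE ?b0// real_normK ?num_real// kb.
rewrite sqnormcE /= mulr_natl mulr2n lerD// P// => x Dx;
  by apply: le_trans (gb x Dx); rewrite sqnormcE ?lerDl ?lerDr sqr_ge0.
Qed.

End complex_integral.

(** * Weighted square norms and closed spans *)

Section weighted_norm.
Context d {T : measurableType d} {R : realType}.
Variables (mu : {measure set T -> \bar R}) (D : set T) (w : T -> R).
Hypotheses (mD : measurable D) (mw : measurable_fun D w)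
  (w0 : forall x, D x -> 0 <= w x).
Implicit Types g h : T -> R[i].

Definition wnorm g : \bar R := (\int[mu]_(x in D) (sqnormc (g x) * w x)%:E)%E.

Definition wL2 g : Prop := cmeasurable_fun D g /\ (wnorm g < +oo)%E.

Lemma wnorm_integrand_ge0 g x : D x -> (0 <= (sqnormc (g x) * w x)%:E)%E.
Proof. by move=> Dx; rewrite lee_fin mulr_ge0 ?sqnormc_ge0 ?w0. Qed.

Lemma measurable_wnorm_integrand g : cmeasurable_fun D g ->
  measurable_fun D (fun x => (sqnormc (g x) * w x)%:E).
Proof.
by move=> mg; apply/measurable_EFinP/measurable_funM => //; exact: measurable_sqnormc.
Qed.

Lemma wnorm_ge0 g : (0 <= wnorm g)%E.
Proof. by apply: integral_ge0 => x; exact: wnorm_integrand_ge0. Qed.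

Lemma eq_wnorm g h : (forall x, D x -> g x = h x) -> wnorm g = wnorm h.
Proof. by move=> gh; apply: eq_integral => x /[!inE] /gh ->. Qed.

Lemma wnormZ c g : cmeasurable_fun D g ->
  wnorm (fun x => c * g x) = ((sqnormc c)%:E * wnorm g)%E.
Proof.
move=> mg; rewrite /wnorm -ge0_integralZl_EFin ?sqnormc_ge0//.
- by apply: eq_integral => x _; rewrite sqnormcM -mulrA EFinM.
- by move=> x; exact: wnorm_integrand_ge0.
- exact: measurable_wnorm_integrand.
Qed.

Lemma wnormD_le (t : R) g h : 0 < t -> cmeasurable_fun D g ->
  cmeasurable_fun D h ->
  (wnorm (fun x => g x + h x)%R <=
    (1 + t)%:E * wnorm g + (1 + t^-1)%:E * wnorm h)%E.
Proof.
move=> t0 mg mh; rewrite /wnorm.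
rewrite -!ge0_integralZl_EFin ?addr_ge0 ?invr_ge0 ?(ltW t0)//; try by
  [move=> x; exact: wnorm_integrand_ge0|exact: measurable_wnorm_integrand].
rewrite -ge0_integralD//.
- apply: ge0_le_integral => //.
  + exact: (wnorm_integrand_ge0 (fun x => g x + h x)).
  + exact/measurable_wnorm_integrand/cmeasurableD.
  + by apply: emeasurable_funD; apply: measurable_funeM;
      exact: measurable_wnorm_integrand.
  + move=> x Dx; rewrite -!EFinM -EFinD lee_fin (mulrA (1 + t)) (mulrA (1 + t^-1)) -mulrDl.
    by rewrite ler_wpM2r ?w0// sqnormcD_le.
- by move=> x Dx; rewrite mule_ge0 ?wnorm_integrand_ge0// lee_fin addr_ge0// ltW.
- exact/measurable_funeM/measurable_wnorm_integrand.
- by move=> x Dx; rewrite mule_ge0 ?wnorm_integrand_ge0// lee_fin addr_ge0// invr_ge0 ltW.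
- exact/measurable_funeM/measurable_wnorm_integrand.
Qed.

Lemma wnormD_le2 g h : cmeasurable_fun D g -> cmeasurable_fun D h ->
  (wnorm (fun x => g x + h x)%R <= 2%:E * (wnorm g + wnorm h))%E.
Proof.
move=> mg mh; apply: le_trans (wnormD_le ltr01 mg mh) _.
rewrite invr1 -[(1 + 1)]/(2%:R : R) -muleDr//.
by rewrite ge0_adde_def// inE wnorm_ge0.
Qed.

Lemma wnorm_le g h : cmeasurable_fun D g -> cmeasurable_fun D h ->
  (forall x, D x -> sqnormc (g x) <= sqnormc (h x)) -> (wnorm g <= wnorm h)%E.
Proof.
move=> mg mh gh; apply: ge0_le_integral => //.
- by move=> x; exact: (wnorm_integrand_ge0 g).
- exact: measurable_wnorm_integrand.
- exact: measurable_wnorm_integrand.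
- by move=> x Dx; rewrite lee_fin ler_wpM2r ?w0// gh.
Qed.

Lemma wnormN g : wnorm (fun x => - g x) = wnorm g.
Proof. by apply: eq_integral => x _; rewrite sqnormcN. Qed.

Lemma wnormB_sym g h : wnorm (fun x => g x - h x) = wnorm (fun x => h x - g x).
Proof. by rewrite -wnormN; apply: eq_wnorm => x _; rewrite opprB. Qed.

Lemma wL2Z c g : wL2 g -> wL2 (fun x => c * g x).
Proof.
move=> [mg g2]; split; first exact: cmeasurableZ.
by rewrite wnormZ// lte_mul_pinfty// lee_fin sqnormc_ge0.
Qed.

Lemma wL2D g h : wL2 g -> wL2 h -> wL2 (fun x => g x + h x).
Proof.
move=> [mg g2] [mh h2]; split; first exact: cmeasurableD.
apply: le_lt_trans (wnormD_le2 mg mh) _.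
by rewrite lte_mul_pinfty// lte_add_pinfty.
Qed.

Lemma wL2B g h : wL2 g -> wL2 h -> wL2 (fun x => g x - h x).
Proof.
move=> g2 /(wL2Z (-1)) h2; have [mgh gh] := wL2D g2 h2; split.
  by apply: eq_cmeasurable mgh => x _; rewrite mulN1r.
by rewrite (@eq_wnorm _ (fun x => g x + -1 * h x))// => x _; rewrite mulN1r.
Qed.

Lemma wL2_0 : wL2 (fun=> 0).
Proof.
split; first exact: cmeasurable_cst.
by rewrite /wnorm integral0_eq// => x _; rewrite sqnormc_real expr0n mul0r.
Qed.

Lemma eq_wL2 g h : (forall x, D x -> g x = h x) -> wL2 g -> wL2 h.
Proof.
by move=> gh [mg g2]; split; [exact: eq_cmeasurable mg|rewrite -(eq_wnorm gh)].
Qed.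

Lemma wL2_sum (I : Type) (s : seq I) (F : I -> T -> R[i]) :
  (forall i, wL2 (F i)) -> wL2 (fun x => \sum_(i <- s) F i x).
Proof.
move=> iF; elim: s => [|i s ih].
  by apply: eq_wL2 wL2_0 => x _; rewrite big_nil.
by apply: eq_wL2 (wL2D (iF i) ih) => x _; rewrite big_cons.
Qed.

Lemma wL2_integrable g : wL2 g ->
  mu.-integrable D (EFin \o (fun x => sqnormc (g x) * w x)).
Proof.
move=> [mg g2]; apply/integrableP; split; first exact: measurable_wnorm_integrand.
apply: le_lt_trans g2; rewrite le_eqVlt; apply/orP; left; apply/eqP.
by apply: eq_integral => x /[!inE] Dx /=; rewrite ger0_norm// mulr_ge0 ?sqnormc_ge0 ?w0.
Qed.

Lemma wL2_fin_num g : wL2 g -> wnorm g \is a fin_num.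
Proof. by move=> [_ g2]; rewrite ge0_fin_numE ?wnorm_ge0. Qed.

(** With p = |g|^2 w and q = |h|^2 w, the squared modulus of the integrand is p q, which is at most
    (p + q)^2. *)
Lemma wprod_integrable g h : wL2 g -> wL2 h ->
  cintegrable mu D (fun x => g x * (h x)^* * (w x)%:C).
Proof.
move=> g2 h2.
apply: (@cintegrable_le _ _ _ _ _ _ _
    (fun x => sqnormc (g x) * w x + sqnormc (h x) * w x)) => //.
- apply: cmeasurableM; last exact: cmeasurable_real.
  by apply: cmeasurableM; [case: g2|apply: cmeasurable_conj; case: h2].
- apply: eq_integrable (integrableD mD (wL2_integrable g2) (wL2_integrable h2)) => //.
- move=> x Dx; rewrite 2!sqnormcM sqnormc_real.
  have -> : sqnormc (h x)^* = sqnormc (h x).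
    by rewrite !sqnormcE cReC cImC sqrrN.
  have a0 : 0 <= sqnormc (g x) * w x by rewrite mulr_ge0 ?sqnormc_ge0 ?w0.
  have b0 : 0 <= sqnormc (h x) * w x by rewrite mulr_ge0 ?sqnormc_ge0 ?w0.
  rewrite (_ : _ * _ * _ = (sqnormc (g x) * w x) * (sqnormc (h x) * w x)); last ring.
  by nra.
Qed.

Lemma wnorm_cintegral g : wL2 g ->
  cintegral mu D (fun x => g x * (g x)^* * (w x)%:C) = (fine (wnorm g))%:C.
Proof.
move=> g2; rewrite [in RHS]/wnorm -cintegral_real.
by apply: eq_cintegral => x Dx; rewrite mulc_conj real_cM.
Qed.

(** The norm of a combination depends only on the Gram matrix of the family. This gives the
    quadratic form of [BN] and also the isometry on simple functions. *)
Lemma cintegral_wprod_sum n (c : 'I_n -> R[i]) (F : 'I_n -> T -> R[i]) :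
  (forall l, wL2 (F l)) ->
  (fine (wnorm (fun x => \sum_(l < n) c l * F l x)))%:C =
  \sum_(l < n) \sum_(m < n) c l * (c m)^* *
    cintegral mu D (fun x => F l x * (F m x)^* * (w x)%:C).
Proof.
move=> F2; rewrite -wnorm_cintegral; last by apply: wL2_sum => i; exact: wL2Z.
transitivity (cintegral mu D (fun x => \sum_(l < n) \sum_(m < n)
    (c l * (c m)^* ) * (F l x * (F m x)^* * (w x)%:C))).
  apply: eq_cintegral => x _; rewrite rmorph_sum mulr_suml mulr_suml.
  apply: eq_bigr => l _; rewrite mulr_sumr mulr_suml.
  by apply: eq_bigr => m _; rewrite rmorphM; ring.
rewrite cintegral_sum//; last first.
  by move=> l; apply: cintegrable_sum => // m; exact/cintegrableZ/wprod_integrable.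
apply: eq_bigr => l _; rewrite cintegral_sum//; last first.
  by move=> m; exact/cintegrableZ/wprod_integrable.
by apply: eq_bigr => m _; rewrite cintegralZ//; exact: wprod_integrable.
Qed.

Lemma wnorm_dct (g_ : nat -> T -> R[i]) g (b : T -> R) :
  (forall n, cmeasurable_fun D (g_ n)) -> cmeasurable_fun D g ->
  mu.-integrable D (EFin \o b) ->
  (forall n x, D x -> sqnormc (g_ n x - g x) * w x <= b x) ->
  {ae mu, forall x, D x -> sqnormc (g_ n x - g x) @[n --> \oo] --> (0 : R)} ->
  forall e : R, 0 < e -> exists n, (wnorm (fun x => g x - g_ n x)%R < e%:E)%E.
Proof.
move=> mg_ mg ib gb g_g e e0.
pose k n x := (sqnormc (g_ n x - g x) * w x)%:E.
have mk n : measurable_fun D (k n).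
  exact/measurable_wnorm_integrand/cmeasurableB.
have k0 : {ae mu, forall x, D x -> k ^~ x @ \oo --> (cst 0%E : T -> \bar R) x}.
  apply: filterS g_g => x + Dx => /(_ Dx) cv.
  apply: cvg_EFin; first exact: nearW.
  rewrite -[X in _ --> X](mul0r (w x)).
  by apply: cvgM => //; exact: cvg_cst.
have kb : {ae mu, forall x n, D x -> (`|k n x| <= (EFin \o b) x)%E}.
  apply: aeW => x n Dx; rewrite lee_fin ger0_norm ?gb//.
  by rewrite mulr_ge0 ?sqnormc_ge0 ?w0.
have [_ _] := dominated_convergence mD mk (measurable_cst _) k0 ib kb.
rewrite integral0 => /fine_cvgP [finn] /cvgrPdist_lt /(_ e e0).
move=> /(filterI finn) [n _ /(_ n (leqnn n))] [/= fn] /=.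
rewrite sub0r normrN ger0_norm ?fine_ge0 ?wnorm_ge0// => ltn.
by exists n; rewrite wnormB_sym -[X in (X < _)%E]fineK// lte_fin.
Qed.

Lemma wnorm0_ae g : cmeasurable_fun D g -> wnorm g = 0%E ->
  {ae mu, forall x, D x -> sqnormc (g x) * w x = 0}.
Proof.
move=> mg g0; have [+ _] := ae_eq_integral_abs mu mD (measurable_wnorm_integrand mg).
have <- : wnorm g = (\int[mu]_(x in D) `|(sqnormc (g x) * w x)%:E|)%E.
  by apply: eq_integral => x /[!inE] Dx; rewrite gee0_abs ?wnorm_integrand_ge0.
by move=> /(_ g0); apply: filterS => x + Dx => /(_ Dx) [].
Qed.

Lemma wnorm_lin_lt c g s h s' (e : R) : 0 < e ->
  cmeasurable_fun D (fun x => g x - s x) ->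
  cmeasurable_fun D (fun x => h x - s' x) ->
  (wnorm (fun x => g x - s x)%R < (e / 4 / (sqnormc c + 1))%:E)%E ->
  (wnorm (fun x => h x - s' x)%R < (e / 4)%:E)%E ->
  (wnorm (fun x => (c * g x + h x) - (c * s x + s' x))%R < e%:E)%E.
Proof.
move=> e0 mgs mhs gs hs; have e4 : 0 < e / 4 by rewrite divr_gt0.
(* The added 1 keeps the divisor positive when c = 0; the two parts e / 4 and the factor 2 of
   [wnormD_le2] add up to e. *)
have c1 : 0 < sqnormc c + 1 by rewrite ltr_wpDl ?sqnormc_ge0.
rewrite (@eq_wnorm _ (fun x => c * (g x - s x) + (h x - s' x))); last first.
  by move=> x _; ring.
apply: le_lt_trans (wnormD_le2 _ _) _ => //; first exact: cmeasurableZ.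
have -> : e%:E = (2%:E * ((e / 4)%:E + (e / 4)%:E))%E.
  by rewrite -EFinD -EFinM; congr _%:E; field.
have le4 : (wnorm (fun x => c * (g x - s x))%R <= (e / 4)%:E)%E.
  rewrite wnormZ//.
  apply: (@le_trans _ _ ((sqnormc c)%:E * (e / 4 / (sqnormc c + 1))%:E)%E).
    by rewrite lee_wpmul2l ?lee_fin ?sqnormc_ge0// ltW.
  rewrite -EFinM lee_fin mulrCA ler_piMr ?(ltW e4)//.
  by rewrite ler_pdivrMr// mul1r lerDl.
rewrite lte_pmul2l//; apply: lee_ltD => //.
by rewrite ge0_fin_numE ?wnorm_ge0// (le_lt_trans le4)// ltry.
Qed.

Definition wclos (S : set (T -> R[i])) g : Prop :=
  cmeasurable_fun D g /\
  forall e : R, 0 < e -> exists s, S s /\ (wnorm (fun x => g x - s x)%R < e%:E)%E.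

Section closure.
Variable S : set (T -> R[i]).
Hypotheses (mS : forall s, S s -> cmeasurable_fun D s)
  (linS : forall c s s', S s -> S s' -> S (fun x => c * s x + s' x)).

Lemma wclos_closed g : cmeasurable_fun D g ->
  (forall e : R, 0 < e -> exists h, wclos S h /\
    (wnorm (fun x => g x - h x)%R < e%:E)%E) -> wclos S g.
Proof.
move=> mg gS; split => // e e0.
have e4 : 0 < e / 4 by rewrite divr_gt0.
have [h [[mh hS] gh]] := gS _ e4; have [s [Ss hs]] := hS _ e4.
exists s; split => //.
rewrite (@eq_wnorm _ (fun x => (g x - h x) + (h x - s x))); last first.
  by move=> x _; rewrite addrA subrK.
apply: le_lt_trans (wnormD_le2 _ _) _;
  [exact: cmeasurableB|by apply: cmeasurableB => //; exact: mS|].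
have -> : e%:E = (2%:E * ((e / 4)%:E + (e / 4)%:E))%E.
  by rewrite -EFinD -EFinM; congr _%:E; field.
by rewrite lte_pmul2l// lteD.
Qed.

Lemma wclos_lin c g h : wclos S g -> wclos S h ->
  wclos S (fun x => c * g x + h x).
Proof.
move=> [mg gS] [mh hS]; split; first exact/cmeasurableD/mh/cmeasurableZ.
move=> e e0; have e4 : 0 < e / 4 by rewrite divr_gt0.
have c1 : 0 < sqnormc c + 1 by rewrite ltr_wpDl ?sqnormc_ge0.
have [s [Ss gs]] := gS _ (divr_gt0 e4 c1); have [s' [Ss' hs]] := hS _ e4.
exists (fun x => c * s x + s' x); split; first exact: linS.
apply: wnorm_lin_lt => //; apply: cmeasurableB => //; exact: mS.
Qed.

Lemma sub_wclos s : S s -> wclos S s.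
Proof.
move=> Ss; split; first exact: mS.
move=> e e0; exists s; split => //.
by rewrite /wnorm integral0_eq// => x _; rewrite subrr sqnormc_real expr0n mul0r.
Qed.

End closure.

End weighted_norm.

(** The selection Q on indices lets one notion of span cover all harmonics, the observed harmonics,
    and indicators paired with their stochastic measures. *)
Definition fspan (R : realType) (I X : Type) (phi : I -> X -> R[i])
    (Q : I -> Prop) (s : X -> R[i]) : Prop :=
  exists n (c : 'I_n -> R[i]) (i : 'I_n -> I), (forall l, Q (i l)) /\
    forall x, s x = \sum_(l < n) c l * phi (i l) x.

Section span.
Context {R : realType} {I X : Type} (phi : I -> X -> R[i]) (Q : I -> Prop).

Lemma fspan_lin c s s' : fspan phi Q s -> fspan phi Q s' ->
  fspan phi Q (fun x => c * s x + s' x).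
Proof.
move=> [n [u [i [Qi us]]]] [m [v [j [Qj vs]]]].
exists (n + m)%N, (fun l => match fintype.split l with inl a => c * u a | inr b => v b end),
  (fun l => match fintype.split l with inl a => i a | inr b => j b end); split.
  by move=> l; case: fintype.splitP => k _.
move=> x; rewrite us vs big_split_ord/= mulr_sumr; congr (_ + _).
  by apply: eq_bigr => l _; rewrite -[lshift _ _]/(unsplit (inl l)) unsplitK mulrA.
by apply: eq_bigr => l _; rewrite -[rshift _ _]/(unsplit (inr l)) unsplitK.
Qed.

Lemma fspan_gen i : Q i -> fspan phi Q (phi i).
Proof.
move=> Qi; exists 1%N, (fun=> 1), (fun=> i); split=> // x.
by rewrite big_ord1 mul1r.
Qed.

Lemma fspan0 : fspan phi Q (fun=> 0).
Proof.
(* I may be empty, so the map from the empty ordinal is defined by absurdity. *)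
exists 0%N, (fun=> 0), (fun l : 'I_0 => False_rect I (elimF idP (ltn0 l) (ltn_ord l))).
by split=> [[]//|x]; rewrite big_ord0.
Qed.

End span.

(** * Density of simple functions *)

Import HBSimple HBNNSimple.

Lemma cvg_sqnormc_real (R : realType) (u : nat -> R) (l : R) :
  u n @[n --> \oo] --> l -> sqnormc ((u n)%:C - l%:C) @[n --> \oo] --> (0 : R).
Proof.
move=> ul; have ul0 : u n - l @[n --> \oo] --> (0 : R).
  by rewrite -(subrr l); apply: cvgB => //; exact: cvg_cst.
have -> : (fun n => sqnormc ((u n)%:C - l%:C)) = (fun n => (u n - l) * (u n - l)).
  by apply/funext => n; rewrite -rmorphB sqnormc_real expr2.
by rewrite -(mulr0 (0 : R)); exact: (cvgM ul0 ul0).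
Qed.

Section indicator_density.
Context d {T : measurableType d} {R : realType}.
Variables (mu : {measure set T -> \bar R}) (D : set T) (w : T -> R).
Hypotheses (mD : measurable D) (mw : measurable_fun D w)
  (w0 : forall x, D x -> 0 <= w x).
Variable S : set (T -> R[i]).
Hypotheses (mS : forall s, S s -> cmeasurable_fun D s)
  (linS : forall c s s', S s -> S s' -> S (fun x => c * s x + s' x)).

Lemma eq_wclos g h : (forall x, D x -> g x = h x) -> wclos mu D w S g ->
  wclos mu D w S h.
Proof.
move=> gh [mg gS]; split; first exact: eq_cmeasurable mg.
move=> e /gS [s [Ss gs]]; exists s; split => //.
rewrite (@eq_wnorm _ _ _ mu D w _ (fun x => g x - s x))// => x Dx.
by rewrite gh.
Qed.

Hypothesis indS : forall A, measurable A -> A `<=` D ->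
  wclos mu D w S (fun x => (\1_A x)%:C).

Let wclosL c g h : wclos mu D w S g -> wclos mu D w S h ->
  wclos mu D w S (fun x => c * g x + h x).
Proof. exact: wclos_lin. Qed.

Let wclos_nnsfun (g : {nnsfun T >-> R}) : wclos mu D w S (fun x => (g x)%:C).
Proof.
have cl0 : wclos mu D w S (fun=> 0).
  apply: eq_wclos (indS measurable0 (@sub0set _ D)) => x _.
  by rewrite indic0.
(* The level sets are cut down to D because [indS] covers only subsets of D; the closure depends
   only on values on D. *)
suff : wclos mu D w S (fun x => \sum_(y <- finmap.enum_fset (fset_set (range g)))
    y%:C * (\1_(g @^-1` [set y] `&` D) x)%:C).
  apply: eq_wclos => x Dx; rewrite [in RHS]fimfunE fsbig_finite//= rmorph_sum; apply: eq_bigr => y _.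
  by rewrite -real_cM indicI /= [\1_D x]indicE mem_set// mulr1.
elim: (finmap.enum_fset _) => [|y s ih].
  by apply: eq_wclos cl0 => x _; rewrite big_nil.
have ind : wclos mu D w S (fun x => (\1_(g @^-1` [set y] `&` D) x)%:C).
  apply: indS; last exact: subIsetr.
  by apply: measurableI => //; exact: measurable_sfunP.
by apply: eq_wclos (wclosL y%:C ind ih) => x _; rewrite big_cons.
Qed.

(** The simple approximants increase to k, so 0 <= k - g_n <= k and k^2 w dominates the squared
    differences. *)
Let wclos_nneg (k : T -> R) : (forall x, D x -> 0 <= k x) ->
  wL2 mu D w (fun x => (k x)%:C) -> wclos mu D w S (fun x => (k x)%:C).
Proof.
move=> k0 [[mk _] k2].
have mk' : measurable_fun D (EFin \o k) by exact/measurable_EFinP.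
have k0' x : D x -> (0 <= (EFin \o k) x)%E by move=> Dx; rewrite lee_fin k0.
pose g n := nnsfun_approx mD mk' n.
have gk x : D x -> g n x @[n --> \oo] --> k x.
  by move=> Dx; exact: (fine_cvg (cvg_nnsfun_approx mD mk' k0' Dx)).
have g_le n x : D x -> 0 <= g n x <= k x.
  move=> Dx; rewrite fun_ge0/= -(cvg_lim _ (gk _ Dx))//.
  apply: nondecreasing_cvgn_le; last by apply/cvg_ex; exists (k x); exact: gk.
  by move=> m p mp; have /lefP := nd_nnsfun_approx mD mk' mp; apply.
have mkc : cmeasurable_fun D (fun x => (k x)%:C) by exact: cmeasurable_real.
have mgc n : cmeasurable_fun D (fun x => (g n x)%:C).
  by apply: cmeasurable_real; apply: measurable_funTS.
apply: (wclos_closed mD mw w0 mS) => // e e0.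
have [|||n gn] := @wnorm_dct _ _ _ mu D w mD mw w0
  (fun n x => (g n x)%:C) (fun x => (k x)%:C)
  (fun x => sqnormc (k x)%:C * w x) mgc mkc _ _ _ e e0.
- exact: (wL2_integrable mw w0).
- move=> n x Dx; rewrite ler_wpM2r ?w0// -rmorphB !sqnormc_real.
  rewrite -[leLHS]real_normK ?num_real// ler_sqr ?nnegrE ?k0//.
  have /andP[g1 g2] := g_le n x Dx.
  by rewrite ler0_norm ?subr_le0// opprB lerBlDr lerDl.
- by apply: aeW => x Dx; apply: cvg_sqnormc_real; exact: gk.
by exists (fun x => (g n x)%:C); split => //; exact: wclos_nnsfun.
Qed.

Lemma wclos_wL2 g : wL2 mu D w g -> wclos mu D w S g.
Proof.
have real_part (k : T -> R) : wL2 mu D w (fun x => (k x)%:C) ->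
    wclos mu D w S (fun x => (k x)%:C).
  move=> k2; have [[mk _] _] := k2.
  (* The signs s = 1 and s = -1 give the positive and the negative part; all that matters about s is
     s^2 = 1. *)
  have P (s : R) : sqnormc s%:C = 1 -> wclos mu D w S (fun x => (Num.max (s * k x) 0)%:C).
    rewrite sqnormc_real => s1.
    have mm : measurable_fun D (fun x => Num.max (s * k x) 0).
      by apply: measurable_maxr => //; apply: measurable_funM.
    apply: wclos_nneg; first by move=> x _; rewrite le_max lexx orbT.
    split; first exact: cmeasurable_real.
    apply: le_lt_trans k2.2; apply: wnorm_le => //; try exact: cmeasurable_real.
    move=> x Dx; rewrite !sqnormc_real -[k x ^+ 2]mul1r -s1 -exprMn.
    by case: (leP (s * k x) 0) => _ //; rewrite expr0n sqr_ge0.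
  have := wclosL (-1) (P (-1) _) (P 1 _).
  rewrite !sqnormc_real sqrrN expr1n => /(_ erefl erefl); apply: eq_wclos => x _.
  rewrite mulN1r -rmorphN -rmorphD mul1r mulN1r; congr _%:C.
  by case: (leP (k x) 0); case: (leP (- k x) 0); rewrite ?oppr_le0 ?oppr_gt0; lra.
move=> g2; have [[m1 m2] gf] := g2.
have part (k : T -> R) : measurable_fun D k ->
    (forall x, D x -> k x ^+ 2 <= sqnormc (g x)) ->
    wclos mu D w S (fun x => (k x)%:C).
  move=> mk kg; apply: real_part; split; first exact: cmeasurable_real.
  apply: le_lt_trans gf; apply: wnorm_le => //.
  by move=> x Dx; rewrite sqnormc_real kg.
have g1 := part _ m1 (fun x _ => _); have g3 := part _ m2 (fun x _ => _).
apply: eq_wclos (wclosL ('i)%C (g3 _) (g1 _)) => x.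
- by move=> _; apply: complex_ext; rewrite ?cReD ?cImD ?cReM ?cImM /=; ring.
- by rewrite sqnormcE lerDr sqr_ge0.
- by rewrite sqnormcE lerDl sqr_ge0.
Qed.

End indicator_density.

(** * Trigonometric polynomials *)

Section trigonometric_span.
Context {R : realType}.
Implicit Types (x : R) (j k : int) (s : R -> R[i]).

Definition trig_span : set (R -> R[i]) := fspan (@expij R) (fun=> True).

Lemma expijD j k x : expij (j + k) x = expij j x * expij k x.
Proof.
by rewrite /expij rmorphD /= mulrDl /expi cosD sinD; apply: complex_ext;
  rewrite ?cReM ?cImM /=; ring.
Qed.

Lemma expij0 x : expij 0 x = 1.
Proof. by rewrite /expij mul0r /expi cos0 sin0. Qed.

Lemma conj_expij j x : (expij j x)^* = expij (- j) x.
Proof. by rewrite /expij rmorphN /= mulNr /expi cosN sinN. Qed.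

Lemma sqnormc_expij j x : sqnormc (expij j x) = 1.
Proof. by rewrite sqnormcE /= cos2Dsin2. Qed.

Lemma cmeasurable_expij (D : set (measurableTypeR R)) j :
  cmeasurable_fun D (@expij R j).
Proof.
have mj : measurable_fun [set: measurableTypeR R] (fun x : R => j%:~R * x).
  by apply: measurable_funM => //; exact: measurable_cst.
split; apply: measurable_funTS.
  by apply: (measurableT_comp _ mj); apply: continuous_measurable_fun; exact: continuous_cos.
by apply: (measurableT_comp _ mj); apply: continuous_measurable_fun; exact: continuous_sin.
Qed.

Lemma cmeasurable_fspan_expij (Q : int -> Prop) (D : set (measurableTypeR R)) s :
  fspan (@expij R) Q s -> cmeasurable_fun D s.
Proof.
move=> [n [c [j [_ sE]]]].
apply: (@eq_cmeasurable _ _ _ D (fun x => \sum_(l < n) c l * expij (j l) x)).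
  by move=> x _; rewrite sE.
by apply: cmeasurable_sum => l; apply: cmeasurableZ; exact: cmeasurable_expij.
Qed.

Lemma trig_span_lin c s s' : trig_span s -> trig_span s' ->
  trig_span (fun x => c * s x + s' x).
Proof. exact: fspan_lin. Qed.

Lemma trig_span_expij j : trig_span (expij j).
Proof. exact: fspan_gen. Qed.

Lemma eq_trig_span s s' : s =1 s' -> trig_span s -> trig_span s'.
Proof. by move=> /funext ->. Qed.

Lemma trig_span_cst c : trig_span (fun=> c).
Proof.
apply: eq_trig_span (trig_span_lin c (trig_span_expij 0) (@fspan0 R _ _ _ _)).
by move=> x; rewrite expij0 mulr1 addr0.
Qed.

Lemma trig_span_mul s s' : trig_span s -> trig_span s' ->
  trig_span (fun x => s x * s' x).
Proof.
move=> [n [c [j [_ sE]]]] [m [u [k [_ s'E]]]].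
have mulj l : trig_span (fun x => expij (j l) x * s' x).
  exists m, u, (fun i => j l + k i); split=> // x; rewrite s'E mulr_sumr.
  by apply: eq_bigr => i _; rewrite expijD; ring.
have -> : (fun x => s x * s' x) =
    (fun x => \sum_(l < n) c l * (expij (j l) x * s' x)).
  by apply/funext => x; rewrite sE mulr_suml; apply: eq_bigr => l _; rewrite mulrA.
elim: (index_enum _) => [|l r ih].
  by apply: eq_trig_span (trig_span_cst 0) => x; rewrite big_nil.
by apply: eq_trig_span (trig_span_lin (c l) (mulj l) ih) => x; rewrite big_cons.
Qed.

Lemma trig_span_exp s n : trig_span s -> trig_span (fun x => s x ^+ n).
Proof.
move=> ts; elim: n => [|n ih]; first exact: trig_span_cst.
by apply: eq_trig_span (trig_span_mul ts ih) => x; rewrite exprS.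
Qed.

Lemma trig_span_cos : trig_span (fun x => (cos x)%:C).
Proof.
have := trig_span_lin (2^-1)%:C (trig_span_expij 1)
  (trig_span_lin (2^-1)%:C (trig_span_expij (-1)) (trig_span_cst 0)).
apply: eq_trig_span => x; rewrite -conj_expij /expij mul1r /expi.
by apply: complex_ext; rewrite ?(cReD, cImD, cReM, cImM) /=; field.
Qed.

Lemma trig_span_sin : trig_span (fun x => (sin x)%:C).
Proof.
have := trig_span_lin (0 -i* 2^-1) (trig_span_expij 1)
  (trig_span_lin (0 +i* 2^-1) (trig_span_expij (-1)) (trig_span_cst 0)).
apply: eq_trig_span => x; rewrite -conj_expij /expij mul1r /expi.
by apply: complex_ext; rewrite ?(cReD, cImD, cReM, cImM) /=; field.
Qed.

(* Equal to (1 - sin ((x - a) / 2) * cos (x / 2)) / 2, hence below 1/2 exactly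
   where a < x < pi. *)
Definition arc_fun (a x : R) : R := 2^-1 - (sin (x - a / 2) - sin (a / 2)) / 4.

(** The half-angle factors change sign at a and at the ends of the period. Neither is 2 pi-periodic,
    but product-to-sum turns their product into a trigonometric polynomial of degree one. *)
Lemma arc_funE a x : arc_fun a x = 2^-1 - sin ((x - a) / 2) * cos (x / 2) / 2.
Proof.
rewrite /arc_fun (_ : x - a / 2 = (x - a) / 2 + x / 2); last by field.
rewrite (_ : a / 2 = x / 2 - (x - a) / 2); last by field.
by rewrite sinD sinB; field.
Qed.

Lemma arc_fun01 a x : 0 <= arc_fun a x <= 1.
Proof.
rewrite /arc_fun; have := sin_geN1 (x - a / 2); have := sin_le1 (x - a / 2).
have := sin_geN1 (a / 2); have := sin_le1 (a / 2).
by move=> *; apply/andP; split; lra.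
Qed.

Lemma trig_span_arc_fun a : trig_span (fun x => (arc_fun a x)%:C).
Proof.
have := trig_span_lin (- cos (a / 2) / 4)%:C trig_span_sin
  (trig_span_lin (sin (a / 2) / 4)%:C trig_span_cos
    (trig_span_cst (2^-1 + sin (a / 2) / 4)%:C)).
apply: eq_trig_span => x; rewrite -!real_cM -!rmorphD; congr _%:C.
by rewrite /arc_fun sinB; field.
Qed.

Lemma arc_fun_lt a x : - pi <= a -> a < x -> x < pi -> arc_fun a x < 2^-1.
Proof.
move=> pa ax xp; rewrite arc_funE ltrBlDr ltrDl divr_gt0// mulr_gt0//.
  by apply: sin_gt0_pi; lra.
by apply: cos_gt0_pihalf; lra.
Qed.

Lemma arc_fun_gt a x : a <= pi -> - pi < x -> x < a -> 2^-1 < arc_fun a x.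
Proof.
move=> pa px xa; rewrite arc_funE ltrBrDr gtrDl pmulr_llt0// nmulr_rlt0.
  by apply: cos_gt0_pihalf; lra.
by rewrite -oppr_gt0 -sinN; apply: sin_gt0_pi; lra.
Qed.

End trigonometric_span.

(** * Powers converging to a step at 1/2 *)

Section power_step.
Context {R : realType}.
Implicit Type y : R.

Lemma bernoulli y n : -1 <= y -> 1 + n%:R * y <= (1 + y) ^+ n.
Proof.
move=> y1; elim: n => [|n ih]; first by rewrite mul0r addr0 expr0.
have y1' : 0 <= 1 + y by lra.
rewrite exprS; apply: le_trans (ler_wpM2l y1' ih).
have : 0 <= n%:R * y ^+ 2 by rewrite mulr_ge0 ?sqr_ge0.
by rewrite -[n.+1%:R]natr1; nra.
Qed.

(** The outer exponent 2^n sets the threshold: 2^n y^n = (2 y)^n tends to 0 for y < 1/2 and to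
    infinity for y > 1/2. *)
Definition step_pow y n : R := (1 - y ^+ n) ^+ (2 ^ n)%N.

Lemma step_powC y n : (step_pow y n)%:C = (1 - y%:C ^+ n) ^+ (2 ^ n).
Proof. by rewrite /step_pow real_cX real_cB real_cX. Qed.

Lemma step_pow01 y n : 0 <= y <= 1 -> 0 <= step_pow y n <= 1.
Proof.
move=> /andP[y0 y1]; have yn0 := exprn_ge0 n y0; have yn1 := exprn_ile1 n y0 y1.
by rewrite exprn_ge0 ?subr_ge0//= exprn_ile1 ?subr_ge0// lerBlDr lerDl.
Qed.

Lemma step_pow_cvg1 y : 0 <= y -> y < 2^-1 -> step_pow y n @[n --> \oo] --> (1 : R).
Proof.
move=> y0 y2; have y1 : 0 <= y <= 1 by lra.
apply: (@squeeze_cvgr _ _ _ _ (fun n => 1 - (2 * y) ^+ n) (fun=> 1)).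
- apply: nearW => n; have /andP[_ ->] := step_pow01 n y1; rewrite andbT.
  (* Bernoulli's inequality gives (1 - y^n)^(2^n) >= 1 - (2 y)^n. *)
  have := @bernoulli (- y ^+ n) (2 ^ n); rewrite natrX exprMn mulrN.
  apply; rewrite lerN2; apply: exprn_ile1; lra.
- rewrite -[X in _ --> X]subr0; apply: cvgB; first exact: cvg_cst.
  by apply: cvg_expr; rewrite ger0_norm; lra.
- exact: cvg_cst.
Qed.

(** Multiplying by (1 + y^n)^(2^n) gives (1 - y^(2 n))^(2^n) <= 1, and by Bernoulli that factor is
    at least (2 y)^n. *)
Lemma step_pow_cvg0 y : y <= 1 -> 2^-1 < y -> step_pow y n @[n --> \oo] --> (0 : R).
Proof.
move=> y1 y2; have y01 : 0 <= y <= 1 by lra.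
have y20 : 0 < 2 * y by lra.
apply: (@squeeze_cvgr _ _ _ _ (fun=> 0) (fun n => ((2 * y)^-1) ^+ n)).
- apply: nearW => n; have /andP[-> _] /= := step_pow01 n y01.
  have yn0 : 0 <= y ^+ n by apply: exprn_ge0; lra.
  have yn1 : y ^+ n <= 1 by apply: exprn_ile1; lra.
  rewrite exprVn -[leRHS]mul1r ler_pdivlMr ?exprn_gt0//.
  apply: (@le_trans _ _ (step_pow y n * (1 + y ^+ n) ^+ (2 ^ n))).
    rewrite ler_wpM2l ?(andP (step_pow01 n y01)).1//.
    have := @bernoulli (y ^+ n) (2 ^ n); rewrite natrX exprMn => b.
    by apply: le_trans (b _); lra.
  by rewrite -exprMn exprn_ile1//; nra.
- exact: cvg_cst.
- apply: cvg_expr; rewrite ger0_norm ?invr_ge0 ?ltW// invf_lt1//; lra.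
Qed.

End power_step.

(** * Density of trigonometric polynomials in L_2(f) *)

Section spectral_weight.
Context {R : realType}.
Notation mu := (@lebesgue_measure R).
Notation RM := (measurableTypeR R).
Notation freq := (@freq R : set RM).

Lemma measurable_freq : measurable freq.
Proof. exact: measurable_itv. Qed.

Lemma pi2_gt0 : 0 < 2 * pi :> R.
Proof. by rewrite mulr_gt0// pi_gt0. Qed.

Lemma pi2V_ge0 : 0 <= (2 * pi)^-1 :> R.
Proof. by rewrite invr_ge0 ltW// pi2_gt0. Qed.

Variable f : R -> R.
Hypothesis fD : is_density f.

(** Absorbing the normalization into the weight makes [wnorm] coincide with [sqnorm_f]. *)
Definition spec_weight (x : R) : R := (2 * pi)^-1 * f x.

Lemma density_measurable : measurable_fun freq (f : RM -> R).
Proof. by apply/measurable_EFinP; exact: measurable_int fD.2. Qed.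

Lemma measurable_spec_weight : measurable_fun freq (spec_weight : RM -> R).
Proof. by apply: measurable_funM => //; exact: density_measurable. Qed.

Lemma spec_weight_ge0 x : freq x -> 0 <= spec_weight x.
Proof. by move=> fx; rewrite mulr_ge0 ?pi2V_ge0// fD.1. Qed.

Lemma spec_weight_integrable : mu.-integrable freq (EFin \o spec_weight).
Proof.
rewrite (_ : EFin \o spec_weight = (fun x => ((2 * pi)^-1)%:E * (EFin \o f) x)%E)//.
exact: (integrableZl measurable_freq _ fD.2).
Qed.

Lemma sqnorm_fE (g : RM -> R[i]) : cmeasurable_fun freq g ->
  sqnorm_f f g = wnorm mu freq spec_weight g.
Proof.
move=> mg; rewrite /sqnorm_f /wnorm -ge0_integralZl_EFin ?pi2V_ge0//.
- by apply: eq_integral => x _; rewrite -EFinM mulrCA.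
- exact: measurable_freq.
- by move=> x fx; rewrite lee_fin mulr_ge0 ?sqnormc_ge0 ?fD.1.
- by apply/measurable_EFinP/measurable_funM; [exact: measurable_sqnormc|exact: density_measurable].
Qed.

Lemma L2E (g : RM -> R[i]) : L2 f g <-> wL2 mu freq spec_weight g.
Proof.
by split=> -[mg g2]; split=> //; [rewrite -sqnorm_fE|rewrite sqnorm_fE].
Qed.

Lemma wL2_bounded (g : RM -> R[i]) (M : R) : cmeasurable_fun freq g ->
  (forall x, freq x -> sqnormc (g x) <= M) -> wL2 mu freq spec_weight g.
Proof.
move=> mg gM; split=> //.
have [_] := integrableP _ _ _ (integrableZl measurable_freq M spec_weight_integrable).
apply: le_lt_trans; apply: ge0_le_integral => //.
- exact: measurable_freq.
- by move=> x fx; rewrite lee_fin mulr_ge0 ?sqnormc_ge0 ?spec_weight_ge0.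
- by apply: measurable_wnorm_integrand => //; exact: measurable_spec_weight.
- apply: measurableT_comp => //; apply: measurable_funeM.
  by apply/measurable_EFinP; exact: measurable_spec_weight.
- move=> x fx /=; rewrite lee_fin (le_trans _ (ler_norm _))//.
  by rewrite ler_wpM2r ?spec_weight_ge0 ?gM.
Qed.

Lemma wL2_expij j : wL2 mu freq spec_weight (expij j).
Proof.
apply: (@wL2_bounded _ 1); first exact: cmeasurable_expij.
by move=> x _; rewrite sqnormc_expij.
Qed.

Let tcl := wclos mu freq spec_weight (@trig_span R).

Let mtrig s : trig_span s -> cmeasurable_fun freq s.
Proof. exact: cmeasurable_fspan_expij. Qed.

Let wf := measurable_spec_weight.
Let wf0 := spec_weight_ge0.

Let tcl_lin c (g h : RM -> R[i]) : tcl g -> tcl h -> tcl (fun x => c * g x + h x).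
Proof.
exact: (@wclos_lin _ _ _ mu _ _ measurable_freq wf wf0 _ mtrig trig_span_lin).
Qed.

Lemma lebesgue_ae_filter : Filter (nbhs (almost_everywhere mu)).
Proof. exact: (@ae_filter_ringOfSetsType _ RM R mu). Qed.

Lemma ae_neq (a : R) : {ae mu, forall x, x != a}.
Proof.
exists [set a]; split => //; first exact: lebesgue_measure_set1.
by move=> x /= /negP; rewrite negbK => /eqP.
Qed.

Lemma indic_sub_le1 (x y : R) : 0 <= x <= 1 -> 0 <= y <= 1 ->
  sqnormc (x%:C - y%:C) <= 1.
Proof.
move=> /andP[x0 x1] /andP[y0 y1]; rewrite -rmorphB sqnormc_real.
by nra.
Qed.

Lemma indic01 (A : set R) x : 0 <= (\1_A x : R) <= 1.
Proof. by rewrite indicE; case: (x \in A); rewrite /= ?lexx ?ler01. Qed.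

(** The three excluded points are those where [arc_fun] equals 1/2; there the powers tend to 1/e,
    which is no value of an indicator. *)
Let ray_step (a : R) x (a1 : - pi <= a) (a2 : a < pi) : freq x -> x != - pi ->
  x != pi -> x != a -> step_pow (arc_fun a x) n @[n --> \oo] --> (\1_(`]a, +oo[) x : R).
Proof.
rewrite /freq /= in_itv/= => /andP[x1 x2] xNpi xpi xa.
have {}x1 : - pi < x by rewrite lt_neqAle eq_sym xNpi.
have {}x2 : x < pi by rewrite lt_neqAle xpi.
have /andP[y0 y1] := arc_fun01 a x.
rewrite indicE; have [ax|] := ltP a x.
  rewrite mem_set/= ?in_itv/= ?ax//; apply: step_pow_cvg1 => //.
  exact: arc_fun_lt.
rewrite le_eqVlt (negbTE xa)/= => {}xa.
rewrite memNset/= ?in_itv/= ?andbT; last by apply/negP; rewrite -leNgt ltW.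
by apply: step_pow_cvg0 => //; apply: arc_fun_gt => //; exact: ltW.
Qed.

Let tcl_ray (a : R) : tcl (fun x => (\1_(`]a, +oo[ : set RM) x)%:C).
Proof.
have cstS c : tcl (fun=> c).
  by apply: sub_wclos; [exact: mtrig|exact: trig_span_cst].
(* For a outside [-pi, pi[ the ray contains all of [freq] or misses it, so the indicator is constant
   there. *)
have [a1|a1] := ltP a (- pi).
  apply: eq_wclos (cstS 1) => x; rewrite /freq /= in_itv/= => /andP[x1 x2].
  by rewrite indicE mem_set//= in_itv/= (lt_le_trans a1 x1).
have [a2|a2] := leP pi a.
  apply: eq_wclos (cstS 0) => x; rewrite /freq /= in_itv/= => /andP[x1 x2].
  rewrite indicE memNset//= in_itv/= andbT; apply/negP.
  by rewrite -leNgt (le_trans x2).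
have mind : cmeasurable_fun freq (fun x => (\1_(`]a, +oo[ : set RM) x : R)%:C).
  by apply: cmeasurable_real; apply: measurable_indic.
have tsp n : trig_span (fun x => (step_pow (arc_fun a x) n)%:C).
  have := trig_span_exp (2 ^ n) (trig_span_lin (-1)
    (trig_span_exp n (trig_span_arc_fun a)) (trig_span_cst 1)).
  apply: eq_trig_span => x; rewrite mulN1r addrC.
  by rewrite step_powC.
apply: (wclos_closed measurable_freq wf wf0 mtrig) => // e e0.
have [|||n n_e] := @wnorm_dct _ _ _ mu freq spec_weight measurable_freq wf wf0
  (fun n x => (step_pow (arc_fun a x) n)%:C) (fun x => (\1_(`]a, +oo[ : set RM) x)%:C)
  spec_weight _ mind spec_weight_integrable _ _ e e0.
- by move=> n; exact: mtrig.
- move=> n x fx; rewrite -[leRHS]mul1r ler_wpM2r ?wf0//.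
  by rewrite indic_sub_le1 ?indic01// step_pow01// arc_fun01.
- have FF := lebesgue_ae_filter.
  apply: filterS3 (ae_neq (- pi)) (ae_neq pi) (ae_neq a) => x h1 h2 h3 fx.
  apply: cvg_sqnormc_real.
  exact: ray_step.
by exists (fun x => (step_pow (arc_fun a x) n)%:C); split => //; exact: sub_wclos.
Qed.

(** Proper differences use linearity of the closure, increasing unions dominated convergence.
    Measurability of A is carried along because [tcl] only sees A inside [freq]. *)
Let tcl_lambda : lambda_system setT [set A : set RM | measurable A /\ tcl (fun x => (\1_A x)%:C)].
Proof.
split => //=.
- split => //; rewrite /tcl; apply: (@eq_wclos _ _ _ _ _ _ _ (fun=> 1)).
    by move=> x _; rewrite indicE in_setT.
  by apply: sub_wclos; [exact: mtrig|exact: trig_span_cst].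
- move=> A B BA [mA tA] [mB tB]; split; first exact: measurableD.
  apply: eq_wclos (tcl_lin (-1) tB tA) => x _.
  rewrite mulN1r addrC -rmorphB; congr _%:C; rewrite !indicE in_setD.
  have [xB|xB] := boolP (x \in B); last by rewrite andbT subr0.
  by rewrite andbF mem_set ?subrr//; apply: BA; rewrite -in_setE.
- move=> F ndF /all_and2[mF tF].
  have mU : measurable (\bigcup_i F i) by exact: bigcupT_measurable.
  have mind : cmeasurable_fun freq (fun x => (\1_(\bigcup_i F i) x : R)%:C).
    by apply: cmeasurable_real; apply: measurable_indic.
  split => //; apply: (@wclos_closed _ _ _ mu _ _ measurable_freq wf wf0 _ mtrig _ mind) => e e0.
  have [|||n n_e] := @wnorm_dct _ _ _ mu freq spec_weight measurable_freq wf wf0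
    (fun n x => (\1_(F n) x)%:C) (fun x => (\1_(\bigcup_i F i) x)%:C)
    spec_weight _ mind spec_weight_integrable _ _ e e0.
  + by move=> n; apply: cmeasurable_real; apply: measurable_indic.
  + move=> n x fx; rewrite -[leRHS]mul1r ler_wpM2r ?wf0//.
    by rewrite indic_sub_le1 ?indic01.
  + apply: aeW => x fx; apply: cvg_sqnormc_real.
    rewrite [in X in _ --> X]indicE; have [|xU] := boolP (x \in \bigcup_i F i).
      rewrite inE => -[m _ Fmx]; apply: cvg_near_cst; exists m => // p /= mp.
      rewrite indicE mem_set//; move: (ndF _ _ mp) => /subsetPset; exact.
    apply: cvg_near_cst; apply: nearW => p; rewrite indicE memNset// => Fpx.
    by move/negP: xU; apply; rewrite inE; exists p.
  exists (fun x => (\1_(F n) x)%:C); split; [exact: tF|exact: n_e].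
Qed.

Lemma trig_span_indic A : measurable A -> tcl (fun x => (\1_A x)%:C).
Proof.
move=> mA; suff [] : [set A : set RM | measurable A /\ tcl (fun x => (\1_A x)%:C)] A by [].
have setIG : setI_closed (RGenOInfty.G (R := R)).
  move=> _ _ [x ->] [y ->]; exists (Num.max x y).
  apply/seteqP; split => z /=; rewrite !in_itv/= !andbT gt_max.
    by move=> [-> ->].
  by move=> /andP[].
have := @lambda_system_subset _ _ setIG setT _ tcl_lambda _ _ A.
apply => //.
  move=> _ [x ->]; split; first exact: measurable_itv.
  exact: tcl_ray.
by have := RGenOInfty.measurableE R; rewrite /measurable /= => <-.
Qed.

Lemma trig_dense g : wL2 mu freq spec_weight g -> tcl g.
Proof.
apply: (wclos_wL2 measurable_freq wf wf0 mtrig trig_span_lin) => A mA _.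
exact: trig_span_indic.
Qed.

End spectral_weight.

(** * The inner product of L_2(f) *)

Section weighted_inner_product.
Context d {T : measurableType d} {R : realType}.
Variables (mu : {measure set T -> \bar R}) (D : set T) (w : T -> R).
Hypotheses (mD : measurable D) (mw : measurable_fun D w)
  (w0 : forall x, D x -> 0 <= w x).
Implicit Types g h : T -> R[i].

Definition winner g h : R[i] :=
  cintegral mu D (fun x => g x * (h x)^* * (w x)%:C).

Notation wL2 := (wL2 mu D w).
Notation wnorm := (wnorm mu D w).

Lemma winner_lin c g g' h : wL2 g -> wL2 g' -> wL2 h ->
  winner (fun x => c * g x + g' x) h = c * winner g h + winner g' h.
Proof.
move=> g2 g2' h2; have i1 := wprod_integrable mD mw w0 g2 h2.
have i2 := wprod_integrable mD mw w0 g2' h2.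
rewrite /winner -cintegralZ// -cintegralD//; last exact: cintegrableZ.
by apply: eq_cintegral => x _; ring.
Qed.

Lemma winnerB g g' h : wL2 g -> wL2 g' -> wL2 h ->
  winner (fun x => g x - g' x) h = winner g h - winner g' h.
Proof.
move=> g2 g2' h2; rewrite [RHS]addrC -mulN1r -winner_lin//.
by apply: eq_cintegral => x _; ring.
Qed.

Lemma winnerC g h : wL2 g -> wL2 h -> winner h g = (winner g h)^*.
Proof.
move=> g2 h2; rewrite -cintegral_conj//; last exact: wprod_integrable.
apply: eq_cintegral => x _.
by apply: complex_ext; rewrite ?(cReC, cImC) !(cReM, cImM) !(cReC, cImC) /=; ring.
Qed.

Lemma winner_suml n (c : 'I_n -> R[i]) (F : 'I_n -> T -> R[i]) h :
  (forall l, wL2 (F l)) -> wL2 h ->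
  winner (fun x => \sum_(l < n) c l * F l x) h = \sum_(l < n) c l * winner (F l) h.
Proof.
move=> F2 h2; have iF l := wprod_integrable mD mw w0 (F2 l) h2.
transitivity (cintegral mu D (fun x => \sum_(l < n) c l * (F l x * (h x)^* * (w x)%:C))).
  apply: eq_cintegral => x _; rewrite !mulr_suml; apply: eq_bigr => l _; ring.
rewrite cintegral_sum//; last by move=> l; exact: cintegrableZ.
by apply: eq_bigr => l _; rewrite cintegralZ.
Qed.

Lemma eq_winner g g' h : (forall x, D x -> g x = g' x) -> winner g h = winner g' h.
Proof. by move=> gg'; apply: eq_cintegral => x Dx; rewrite gg'. Qed.

Lemma winner0l h : winner (fun=> 0) h = 0.
Proof.
by rewrite -[RHS](cintegral0 mu D); apply: eq_cintegral => x _; rewrite !mul0r.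
Qed.

Lemma wnorm_pythagoras g h : wL2 g -> wL2 h -> winner g h = 0 ->
  wnorm (fun x => g x + h x) = (wnorm g + wnorm h)%E.
Proof.
move=> g2 h2 gh0; have hg0 : winner h g = 0 by rewrite (winnerC g2 h2) gh0 rmorph0.
have gh2 := wL2D mD mw w0 g2 h2.
have F k : wL2 k -> wnorm k \is a fin_num by exact: wL2_fin_num.
rewrite -(fineK (F _ gh2)) -(fineK (F _ g2)) -(fineK (F _ h2)) -EFinD; congr _%:E.
have N k : wL2 k -> (fine (wnorm k))%:C = winner k k.
  by move=> k2; rewrite -(wnorm_cintegral k2).
have Nc k : wL2 k -> (winner k k)^* = winner k k.
  by move=> k2; rewrite -N//; apply: complex_ext; rewrite ?cReC ?cImC /= ?oppr0.
have E k : wL2 k -> winner (fun x => g x + h x) k = winner g k + winner h k.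
  move=> k2; rewrite -[winner g k]mul1r -winner_lin//.
  by apply: eq_winner => x _; rewrite mul1r.
apply: (@complexI R); rewrite rmorphD /= !N//.
rewrite E// (winnerC gh2 g2) (winnerC gh2 h2) !E// gh0 hg0 addr0 add0r.
by rewrite !Nc.
Qed.

(** With G and H the squared norms of g and h, the integrand is bounded by t |g|^2 w + t^-1 |h|^2 w,
    of integral t G + H / t. First t is taken large enough to control H / t, then G small enough to
    control t G. *)
Lemma winner_continuous h : wL2 h -> forall e : R, 0 < e ->
  exists2 dl : R, 0 < dl & forall g, wL2 g -> (wnorm g < dl%:E)%E ->
    sqnormc (winner g h) < e.
Proof.
(* Since 2 eta is at most 1 and at most e, 2 eta^2 < e; the 2 is the one of
   [sqnormc_cintegral_le]. *)
move=> h2 e e0; pose eta : R := Num.min 1 e / 2; pose H := fine (wnorm h).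
have m0 : 0 < Num.min 1 e by rewrite lt_min ltr01.
have eta0 : 0 < eta by rewrite divr_gt0.
have H0 : 0 <= H by rewrite fine_ge0// wnorm_ge0.
pose t := 2 * (H + 1) / eta.
have t0 : 0 < t by rewrite divr_gt0// mulr_gt0// ltr_wpDl.
exists (eta / (2 * t)); first by rewrite divr_gt0// mulr_gt0.
move=> g g2 gd; pose G := fine (wnorm g).
have Gd : G < eta / (2 * t).
  by rewrite -lte_fin fineK//; exact: wL2_fin_num.
have G0 : 0 <= G by rewrite fine_ge0// wnorm_ge0.
have iG := wL2_integrable mw w0 g2; have iH := wL2_integrable mw w0 h2.
pose b x := t * (sqnormc (g x) * w x) + t^-1 * (sqnormc (h x) * w x).
have iZ (r : R) k : mu.-integrable D (EFin \o k) ->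
  mu.-integrable D (EFin \o (fun x => r * k x)).
  by move=> ik; apply: eq_integrable (integrableZl mD r ik).
have ib : mu.-integrable D (EFin \o b).
  by apply: eq_integrable (integrableD mD (iZ t _ iG) (iZ t^-1 _ iH)).
have intb : \int[mu]_(x in D) b x = t * G + t^-1 * H.
  rewrite RintegralD//; [|exact: iZ|exact: iZ].
  by rewrite !RintegralZl.
have sg x : D x -> 0 <= sqnormc (g x) * w x.
  by move=> Dx; rewrite mulr_ge0 ?sqnormc_ge0 ?w0.
have sh x : D x -> 0 <= sqnormc (h x) * w x.
  by move=> Dx; rewrite mulr_ge0 ?sqnormc_ge0 ?w0.
apply: (@le_lt_trans _ _ (2 * (\int[mu]_(x in D) b x) ^+ 2)).
  apply: sqnormc_cintegral_le => //.
  - exact: wprod_integrable.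
  - by move=> x Dx; rewrite addr_ge0// mulr_ge0 ?sg ?sh ?invr_ge0// ltW.
  - move=> x Dx; rewrite 2!sqnormcM sqnormc_real.
    have -> : sqnormc (h x)^* = sqnormc (h x) by rewrite !sqnormcE cReC cImC sqrrN.
    rewrite (_ : _ * _ * _ = (t * (sqnormc (g x) * w x)) * (t^-1 * (sqnormc (h x) * w x))).
      have := mulr_ge0 (ltW t0) (sg x Dx).
      have := mulr_ge0 (ltW (_ : 0 < t^-1)) (sh x Dx); rewrite invr_gt0 => /(_ t0).
      by rewrite /b; nra.
    by field; rewrite gt_eqF.
rewrite intb.
have tG : t * G <= eta / 2.
  apply: (@le_trans _ _ (t * (eta / (2 * t)))); first by rewrite ler_wpM2l ?ltW.
  by rewrite le_eqVlt; apply/orP; left; apply/eqP; field; rewrite gt_eqF.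
have tH : t^-1 * H < eta / 2.
  rewrite /t invf_div mulrAC ltr_pdivrMr ?mulr_gt0 ?ltr_wpDl//.
  by rewrite mulrA divfK ?pnatr_eq0// ltr_pM2l// ltrDl.
have tG0 : 0 <= t * G by rewrite mulr_ge0// ltW.
have tH0 : 0 <= t^-1 * H by rewrite mulr_ge0// invr_ge0 ltW.
have [m1 me] : Num.min 1 e <= 1 /\ Num.min 1 e <= e.
  by rewrite !ge_min !lexx orbT.
have etaE : Num.min 1 e = 2 * eta by rewrite /eta; field.
move: m1 me; rewrite etaE => m1 me.
have tGH0 : 0 <= t * G + t^-1 * H by rewrite addr_ge0.
have tGH : t * G + t^-1 * H < eta by rewrite [ltRHS]splitr; apply: ler_ltD.
apply: le_lt_trans (_ : 2 * eta ^+ 2 < e).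
  by rewrite ler_wpM2l// ler_sqr ?nnegrE// ltW.
by rewrite expr2; nra.
Qed.

Lemma winner_null g h : wL2 g -> wL2 h -> wnorm g = 0%E -> winner g h = 0.
Proof.
move=> g2 h2 g0; apply: sqnormc0_eq0; apply/eqP; rewrite eq_le sqnormc_ge0 andbT.
apply/ler_addgt0Pr => e e0; rewrite add0r.
have [dl dl0 gd] := winner_continuous h2 e0.
by apply/ltW/gd => //; rewrite g0 lte_fin.
Qed.

(** The terms are indexed by a list so that continuity goes by induction, one rank-one correction at
    a time. *)
Definition wresid (K : Type) (s : seq K) (e psi : K -> T -> R[i]) g x : R[i] :=
  g x - \sum_(k <- s) winner g (psi k) * e k x.

Section residual.
Variables (K : Type) (s : seq K) (e psi : K -> T -> R[i]).
Hypotheses (e2 : forall k, wL2 (e k)) (psi2 : forall k, wL2 (psi k)).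

Lemma wresid_lin c g g' x : wL2 g -> wL2 g' ->
  wresid s e psi (fun x => c * g x + g' x) x =
  c * wresid s e psi g x + wresid s e psi g' x.
Proof.
move=> g2 g2'; rewrite /wresid.
under eq_bigr do rewrite winner_lin// mulrDl -mulrA.
by rewrite big_split/= -mulr_sumr; ring.
Qed.

Lemma wresid_continuous (eps : R) : 0 < eps ->
  exists2 dl : R, 0 < dl & forall g, wL2 g -> (wnorm g < dl%:E)%E ->
    (wnorm (wresid s e psi g) < eps%:E)%E.
Proof.
rewrite /wresid; elim: s eps => [|k r ih] eps eps0.
  exists eps => // g g2; rewrite (@eq_wnorm _ _ _ mu D w _ g)//.
  by move=> x _; rewrite big_nil subr0.
have eps4 : 0 < eps / 4 by rewrite divr_gt0.
have [d1 d10 h1] := ih _ eps4.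
pose M := fine (wnorm (e k)).
have M0 : 0 <= M by rewrite fine_ge0// wnorm_ge0.
have epsM : 0 < eps / 4 / (M + 1) by rewrite divr_gt0// ltr_wpDl.
have [d2 d20 h2] := winner_continuous (psi2 k) epsM.
exists (Num.min d1 d2); first by rewrite lt_min d10.
move=> g g2 gd.
have gd1 : (wnorm g < d1%:E)%E by apply: lt_le_trans gd _; rewrite lee_fin ge_min lexx.
have gd2 : (wnorm g < d2%:E)%E.
  by apply: lt_le_trans gd _; rewrite lee_fin ge_min lexx orbT.
rewrite (@eq_wnorm _ _ _ mu D w _ (fun x => (g x - \sum_(k <- r) winner g (psi k) * e k x)
    + (- winner g (psi k)) * e k x)); last first.
  by move=> x _; rewrite big_cons; ring.
have r2 : wL2 (fun x => g x - \sum_(k <- r) winner g (psi k) * e k x).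
  by apply: wL2B => //; apply: wL2_sum => // i; exact: wL2Z.
apply: le_lt_trans (@wnormD_le2 _ _ _ mu D w mD mw w0 _
  (fun x => - winner g (psi k) * e k x) _ _) _.
- by have [] := r2.
- by have [] := wL2Z mD mw w0 (- winner g (psi k)) (e2 k).
have -> : eps%:E = (2%:E * ((eps / 4)%:E + (eps / 4)%:E))%E.
  by rewrite -EFinD -EFinM; congr _%:E; field.
rewrite lte_pmul2l//; apply: lteD; first exact: h1.
rewrite (wnormZ mu mD mw w0); last by case: (e2 k).
rewrite sqnormcN -[wnorm (e k)]fineK; last exact: wL2_fin_num.
rewrite -EFinM lte_fin -/M.
apply: (@le_lt_trans _ _ (eps / 4 / (M + 1) * M)).
  by rewrite ler_wpM2r// ltW// h2.
by rewrite mulrAC ltr_pdivrMr ?ltr_wpDl// ltr_pM2l// ltrDl.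
Qed.

End residual.

End weighted_inner_product.

(** * The system biorthogonal to the harmonics *)

Section fourier.
Context {R : realType}.
Notation mu := (@lebesgue_measure R).
Notation RM := (measurableTypeR R).
Notation freq := (@freq R : set RM).

Lemma integral_freq_derive (F g : R -> R) :
  (forall x : R, is_derive x 1 F (g x)) -> continuous g ->
  \int[mu]_(x in freq) g x = F pi - F (- pi).
Proof.
move=> dF cg; have cF : continuous F.
  by move=> x; apply/differentiable_continuous/derivable1_diffP; exact: ex_derive.
rewrite /Rintegral (@continuous_FTC2 R g F (- pi) pi)//.
- by have := pi_gt0 R; lra.
- exact: continuous_subspaceT.
- split; first by move=> x _; exact: ex_derive.
    exact/cvg_at_right_filter/cF.
  exact/cvg_at_left_filter/cF.
- by move=> x _; rewrite derive1E derive_val.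
Qed.

Lemma is_derive_scale (c x : R) : is_derive x 1 (fun y : R => c * y) c.
Proof.
have h := is_deriveZ c (is_derive_id x (1 : R)).
by apply: (is_derive_eq h); rewrite /GRing.scale /= mulr1.
Qed.

Lemma sin_intmul_pi (m : int) : sin (m%:~R * pi) = 0 :> R.
Proof.
have P n : sin (n%:R * pi) = 0 :> R.
  elim: n => [|n ih]; first by rewrite mul0r sin0.
  by rewrite -natr1 mulrDl mul1r sinDpi ih oppr0.
case: m => n; first exact: P.
by rewrite NegzE rmorphN /= mulNr sinN P oppr0.
Qed.

Lemma continuous_scale_comp (c : R) (g : R -> R) : continuous g ->
  continuous (fun x => g (c * x)).
Proof.
by move=> cg x; apply: continuous_comp; [exact: mulrl_continuous|exact: cg].
Qed.

Lemma integral_cos_freq (m : int) : m != 0 ->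
  \int[mu]_(x in freq) cos (m%:~R * x) = 0.
Proof.
move=> m0; have m0' : m%:~R != 0 :> R by rewrite intr_eq0.
have dF (x : R) : is_derive x 1 (fun x => (m%:~R)^-1 * sin (m%:~R * x)) (cos (m%:~R * x)).
  have h := is_derive1_comp (is_derive_sin (m%:~R * x)) (is_derive_scale m%:~R x).
  by apply: (is_derive_eq (is_deriveZ (m%:~R)^-1 h)); rewrite /GRing.scale /=; field.
rewrite (integral_freq_derive dF (continuous_scale_comp (@continuous_cos R))).
by rewrite mulrN sinN sin_intmul_pi oppr0 subrr.
Qed.

Lemma integral_sin_freq (m : int) : \int[mu]_(x in freq) sin (m%:~R * x) = 0.
Proof.
have [->|m0] := eqVneq m 0.
  rewrite (@eq_Rintegral _ _ _ mu freq (fun=> 0)); last first.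
    by move=> x _; rewrite mul0r sin0.
  by rewrite /Rintegral integral0_eq.
have m0' : m%:~R != 0 :> R by rewrite intr_eq0.
have dF (x : R) : is_derive x 1 (fun x => - (m%:~R)^-1 * cos (m%:~R * x)) (sin (m%:~R * x)).
  have h := is_derive1_comp (is_derive_cos (m%:~R * x)) (is_derive_scale m%:~R x).
  by apply: (is_derive_eq (is_deriveZ (- (m%:~R)^-1) h)); rewrite /GRing.scale /=; field.
rewrite (integral_freq_derive dF (continuous_scale_comp (@continuous_sin R))).
by rewrite mulrN cosN subrr.
Qed.

Lemma cintegrable_expij (m : int) : cintegrable mu freq (@expij R m).
Proof.
apply: (@cintegrable_le _ _ _ mu freq (@measurable_freq R) _ (cst 1)).
- exact: cmeasurable_expij.
- apply: continuous_compact_integrable; first exact: segment_compact.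
  by apply: continuous_subspaceT => x; exact: cvg_cst.
- by move=> x _; rewrite sqnormc_expij expr1n.
Qed.

Lemma cintegral_expij (m : int) :
  cintegral mu freq (@expij R m) = (if m == 0 then 2 * pi else 0)%:C.
Proof.
have [->|m0] := eqVneq m 0; last first.
  by rewrite /cintegral /expij /expi /= integral_cos_freq// integral_sin_freq.
rewrite (@eq_cintegral _ _ _ mu _ _ (fun=> (1:R)%:C)); last first.
  by move=> x _; rewrite expij0.
rewrite cintegral_real Rintegral_cst; last exact: measurable_freq.
have := @lebesgue_measure_itv R `[- pi, pi]; rewrite /= lte_fin.
have pi0 := pi_gt0 R; rewrite ifT; last by lra.
by rewrite -EFinD => -> /=; rewrite mul1r; congr _%:C; lra.
Qed.

Variable f : R -> R.
Hypotheses (fD : is_density f) (fM : minimal f).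

Notation w := (spec_weight f).

Lemma measurable_finv : measurable_fun freq ((fun x => (f x)^-1) : RM -> R).
Proof.
(* The power -1 agrees with the inverse on nonnegative reals, including 0, where both are 0. *)
have mp : measurable_fun freq ((fun x => (f x) `^ (-1)) : RM -> R).
  exact: (measurableT_comp (@measurable_powR R (-1)) (density_measurable fD)).
by apply: eq_measurable_fun mp => x /[!inE] fx; rewrite powR_inv1// fD.1.
Qed.

Lemma measurable_finve : measurable_fun freq ((fun x => ((f x)%:E^-1)%E) : RM -> \bar R).
Proof.
rewrite (_ : (fun x => _) = (fun x => if f x == 0 then +oo%E else ((f x)^-1)%:E)); last first.
  by apply/funext => x; rewrite inver.
apply: measurable_fun_if; first exact: measurable_freq.
- by apply: measurable_fun_eqr; [exact: density_measurable|exact: measurable_cst].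
- exact: measurable_cst.
- apply: (@measurable_funS _ _ _ _ freq); [exact: measurable_freq|exact: subIsetl|].
  by apply/measurable_EFinP; exact: measurable_finv.
Qed.

Lemma finve_ge0 x : freq x -> (0 <= (f x)%:E^-1)%E.
Proof. by move=> fx; rewrite inve_ge0 lee_fin fD.1. Qed.

Lemma finve_integrable : mu.-integrable freq (fun x => ((f x)%:E^-1)%E).
Proof.
apply/integrableP; split; first exact: measurable_finve.
apply: le_lt_trans fM; rewrite le_eqVlt; apply/orP; left; apply/eqP.
by apply: eq_integral => x /[!inE] fx; rewrite gee0_abs ?finve_ge0.
Qed.

(** An integrable function is finite almost everywhere, and the extended inverse is +oo at zeros of
    f. *)
Lemma density_neq0 : {ae mu, forall x, freq x -> f x != 0}.
Proof.
have := integrable_ae (@measurable_freq R) finve_integrable.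
have FF := @lebesgue_ae_filter R.
apply: filterS => x + fx => /(_ fx); apply: contraTN => /eqP ->.
by rewrite inve0.
Qed.

(** The real inverse is dominated by the extended one: at a zero of f they are 0 and +oo. *)
Lemma finv_integrable : mu.-integrable freq (EFin \o (fun x => (f x)^-1)).
Proof.
apply: le_integrable finve_integrable; first exact: measurable_freq.
  by apply/measurable_EFinP; exact: measurable_finv.
move=> x fx; rewrite [leRHS]gee0_abs ?finve_ge0//= ger0_norm ?invr_ge0 ?fD.1//.
by rewrite inver; case: ifP => // _; rewrite leey.
Qed.

Lemma cintegrable_finv_expij m :
  cintegrable mu freq (fun x => ((f x)^-1)%:C * expij m x).
Proof.
apply: (@cintegrable_le _ _ _ mu freq (@measurable_freq R) _ (fun x => (f x)^-1)).
- by apply: cmeasurableM; [apply: cmeasurable_real; exact: measurable_finv|exact: cmeasurable_expij].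
- exact: finv_integrable.
- by move=> x _; rewrite sqnormcM sqnormc_expij sqnormc_real mulr1.
Qed.

Definition dual_expij (k : int) (x : R) : R[i] := expij k x * ((f x)^-1)%:C.

Lemma wL2_dual_expij k : wL2 mu freq w (dual_expij k).
Proof.
split.
  by apply: cmeasurableM; [exact: cmeasurable_expij|apply: cmeasurable_real; exact: measurable_finv].
have [_] := integrableP _ _ _ (integrableZl (@measurable_freq R) (2 * pi)^-1 finv_integrable).
apply: le_lt_trans; rewrite le_eqVlt; apply/orP; left; apply/eqP.
apply: eq_integral => x /[!inE] fx /=.
rewrite ger0_norm ?mulr_ge0 ?pi2V_ge0 ?invr_ge0 ?fD.1//; congr _%:E.
rewrite sqnormcM sqnormc_expij sqnormc_real mul1r /spec_weight.
(* The identity f^-2 f = f^-1 holds at zeros of f too, so the integrands agree on all of [freq]. *)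
have [->|f0] := eqVneq (f x) 0; first by rewrite invr0 expr0n mul0r mulr0.
by rewrite mulrCA expr2 -mulrA mulVf// mulr1.
Qed.

Lemma winner_dual_expij j k :
  winner mu freq w (dual_expij j) (dual_expij k) = fourier_inv f (k - j).
Proof.
rewrite /fourier_inv /spec_integral -cintegralZ; last exact: cintegrable_finv_expij.
  apply: eq_cintegral => x fx; rewrite opprB expijD -conj_expij /dual_expij rmorphM /=.
  have -> : (((f x)^-1)%:C)^* = ((f x)^-1)%:C :> R[i].
    by apply: complex_ext; rewrite ?cReC ?cImC /= ?oppr0.
  rewrite /spec_weight real_cM.
  have : ((f x)^-1)%:C * ((f x)^-1)%:C * (f x)%:C = ((f x)^-1)%:C :> R[i].
    rewrite -!real_cM; congr _%:C.
    have [->|f0] := eqVneq (f x) 0; first by rewrite invr0 !mul0r.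
    by rewrite -mulrA mulVf// mulr1.
  set u := ((f x)^-1)%:C => uu; rewrite -[in RHS]uu; ring.
exact: measurable_freq.
Qed.

(** The weight must cancel 1/f exactly. Since f f^-1 = 1 fails at zeros of f, the integrands agree
    only almost everywhere; what remains is the orthogonality of the exponentials. *)
Lemma winner_expij_dual j k :
  winner mu freq w (expij j) (dual_expij k) = (j == k)%:R.
Proof.
transitivity (((2 * pi)^-1)%:C * cintegral mu freq (@expij R (j - k))); last first.
  rewrite cintegral_expij subr_eq0; case: (j == k); last by rewrite mulr0.
  by rewrite -real_cM mulVf// gt_eqF// pi2_gt0.
rewrite -cintegralZ; [|exact: measurable_freq|exact: cintegrable_expij].
have ae_part (F G : RM -> R) : measurable_fun freq F -> measurable_fun freq G ->
    {ae mu, forall x, freq x -> F x = G x} ->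
    \int[mu]_(x in freq) F x = \int[mu]_(x in freq) G x.
  move=> mF mG FG; rewrite /Rintegral; congr fine; apply: ae_eq_integral.
  - exact: measurable_freq.
  - exact/measurable_EFinP.
  - exact/measurable_EFinP.
  - have FF := @lebesgue_ae_filter R.
    by apply: filterS FG => x + fx => /(_ fx) ->.
have eqf : {ae mu, forall x, freq x ->
    expij j x * (dual_expij k x)^* * (w x)%:C = ((2 * pi)^-1)%:C * expij (j - k) x}.
  have FF := @lebesgue_ae_filter R.
  apply: filterS density_neq0 => x + fx => /(_ fx) f0.
  rewrite expijD -conj_expij /dual_expij rmorphM /=.
  have -> : (((f x)^-1)%:C)^* = ((f x)^-1)%:C :> R[i].
    by apply: complex_ext; rewrite ?cReC ?cImC /= ?oppr0.
  rewrite /spec_weight real_cM.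
  have : ((f x)^-1)%:C * (f x)%:C = 1 :> R[i] by rewrite -real_cM mulVf.
  set u := ((f x)^-1)%:C => uu; rewrite -[RHS]mul1r -uu; ring.
have [m1 m2] : cmeasurable_fun freq (fun x => expij j x * (dual_expij k x)^* * (w x)%:C).
  apply: cmeasurableM.
    apply: cmeasurableM; first exact: cmeasurable_expij.
    by apply: cmeasurable_conj; have [] := wL2_dual_expij k.
  by apply: cmeasurable_real; exact: measurable_spec_weight.
have [m3 m4] : cmeasurable_fun freq (fun x => ((2 * pi)^-1)%:C * expij (j - k) x).
  by apply: cmeasurableZ; exact: cmeasurable_expij.
have FF := @lebesgue_ae_filter R.
rewrite /winner /cintegral; congr (_ +i* _); apply: ae_part => //.
  by apply: filterS eqf => x + fx => /(_ fx) ->.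
by apply: filterS eqf => x + fx => /(_ fx) ->.
Qed.

End fourier.

(** * The interpolation problem *)

Section interpolation.
Context {R : realType}.
Notation mu := (@lebesgue_measure R).
Notation RM := (measurableTypeR R).
Notation freq := (@freq R : set RM).

Variables (N : nat) (f : R -> R).
Hypotheses (fD : is_density f) (fM : minimal f).

Notation w := (spec_weight f).
Notation wL2 := (wL2 mu freq w).
Notation wnorm := (wnorm mu freq w).
Notation winner := (winner mu freq w).

Let mF := @measurable_freq R.
Let mw := measurable_spec_weight fD.
Let w0 := spec_weight_ge0 fD.

Definition low_expij (j : 'I_N.+1) : R -> R[i] := expij (j : nat)%:Z.
Definition low_dual (j : 'I_N.+1) : R -> R[i] := dual_expij f (j : nat)%:Z.

Let e2 (j : 'I_N.+1) : wL2 (low_expij j). Proof. exact: wL2_expij. Qed.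
Let psi2 (j : 'I_N.+1) : wL2 (low_dual j). Proof. exact: wL2_dual_expij. Qed.

Let obs : set (RM -> R[i]) := fspan (@expij R) (fun j => observed N j).

Let mobs s : obs s -> cmeasurable_fun freq s.
Proof. exact: cmeasurable_fspan_expij. Qed.

Lemma L2NP (g : RM -> R[i]) : L2N N f g <-> wL2 g /\ wclos mu freq w obs g.
Proof.
split.
  move=> [/(L2E fD) g2 gN]; split=> //; split; first by case: g2.
  move=> e /gN [n [c [j [jo ge]]]]; exists (fun x => \sum_(l < n) c l * expij (j l) x).
  have so : obs (fun x => \sum_(l < n) c l * expij (j l) x) by exists n, c, j.
  split=> //; rewrite -sqnorm_fE//; apply: cmeasurableB; [by case: g2|exact: mobs].
move=> [g2 [mg gN]]; split; first exact/(L2E fD).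
move=> e /gN [s [so ge]]; have [n [c [j [jo sE]]]] := so.
exists n, c, j; split=> //; rewrite sqnorm_fE//; last first.
  apply: cmeasurableB => //; apply: mobs; by exists n, c, j.
by move: ge; rewrite (_ : s = (fun x => \sum_(l < n) c l * expij (j l) x))//; apply/funext.
Qed.

Lemma observed_dual0 s (k : 'I_N.+1) : obs s -> winner s (low_dual k) = 0.
Proof.
move=> [n [c [j [jo sE]]]].
rewrite (@eq_winner _ _ _ mu freq w _ (fun x => \sum_(l < n) c l * expij (j l) x)); last first.
  by move=> x _; rewrite sE.
rewrite winner_suml//; last by move=> l; exact: wL2_expij.
rewrite big1// => l _; rewrite winner_expij_dual//.
have [jk|//] := eqVneq (j l) (k : nat)%:Z; last by rewrite mulr0.
by have := jo l; rewrite /observed jk /= lez_nat -ltnS ltn_ord.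
Qed.

Lemma L2N_dual0 (g : RM -> R[i]) (k : 'I_N.+1) : L2N N f g -> winner g (low_dual k) = 0.
Proof.
move=> /L2NP [g2 [mg gN]].
apply: sqnormc0_eq0; apply/eqP; rewrite eq_le sqnormc_ge0 andbT.
apply/ler_addgt0Pr => e e0; rewrite add0r.
have [dl dl0 gd] := winner_continuous mF mw w0 (psi2 k) e0.
have [s [so gs]] := gN _ dl0.
(* Here s = g - (g - s), where g is in L_2(f) and g - s has finite norm. *)
have s2 : wL2 s.
  have gs2 : wL2 (fun x => g x - s x).
    split; first by apply: cmeasurableB => //; exact: mobs.
    exact: lt_trans gs (ltry _).
  by have := wL2B mF mw w0 g2 gs2; apply: eq_wL2 => x _; rewrite opprB addrC subrK.
have gs2 := wL2B mF mw w0 g2 s2.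
by rewrite -[winner g _]subr0 -(observed_dual0 k so) -winnerB// ltW// gd.
Qed.

Let resid (g : RM -> R[i]) : RM -> R[i] :=
  wresid mu freq w (index_enum 'I_N.+1) low_expij low_dual g.

(** By biorthogonality an observed harmonic has zero coefficients and is kept, while a missing one
    is subtracted from itself. *)
Lemma resid_expij_observed (j : int) : obs (resid (expij j)).
Proof.
have [oj|] := boolP (observed N j).
  rewrite (_ : resid _ = expij j); first exact: fspan_gen.
  apply/funext => x; rewrite /resid /wresid big1 ?subr0// => k _.
  by rewrite (observed_dual0 k (fspan_gen (@expij R) (Q := fun j => observed N j) oj)) mul0r.
rewrite negbK => /andP[j0 jN].
have jn : (`|j| < N.+1)%N by rewrite ltnS -lez_nat gez0_abs.
have jE : j = (`|j|)%N%:Z by rewrite gez0_abs.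
rewrite (_ : resid _ = (fun=> 0)); first exact: fspan0.
apply/funext => x; rewrite /resid /wresid (bigD1 (Ordinal jn))//= big1 ?addr0.
  by rewrite winner_expij_dual//= -jE eqxx mul1r /low_expij /= -jE subrr.
move=> k kj; rewrite winner_expij_dual//.
have -> : (j == (k : nat)%:Z) = false; last by rewrite mul0r.
by apply/negbTE; apply: contraNneq kj => jk; apply/eqP/val_inj; rewrite /= jk.
Qed.

Lemma resid_trig_observed s : trig_span s -> obs (resid s).
Proof.
move=> [n [c [j [_ sE]]]].
have -> : s = (fun x => \sum_(l < n) c l * expij (j l) x) by apply/funext.
elim: (index_enum 'I_n) => [|l r ih].
  rewrite (_ : resid _ = (fun=> 0)); first exact: fspan0.
  apply/funext => x; rewrite /resid /wresid big_nil big1 ?subrr// => k _.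
  rewrite (@eq_winner _ _ _ mu freq w _ (fun=> 0)) ?winner0l ?mul0r// => y _.
  by rewrite big_nil.
have r2 : wL2 (fun x => \sum_(l <- r) c l * expij (j l) x).
  by apply: wL2_sum => // i; apply: wL2Z => //; exact: wL2_expij.
have := fspan_lin (c l) (resid_expij_observed (j l)) ih.
congr (fspan _ _ _); apply/funext => x.
rewrite -wresid_lin//; last exact: wL2_expij.
by congr (wresid _ _ _ _ _ _ _ _); apply/funext => y; rewrite big_cons.
Qed.

Lemma dual0_L2N (g : RM -> R[i]) : wL2 g ->
  (forall k, winner g (low_dual k) = 0) -> L2N N f g.
Proof.
move=> g2 g0; apply/L2NP; split=> //; split; first by case: g2.
move=> e e0.
have [dl dl0 rd] := wresid_continuous mF mw w0 (index_enum 'I_N.+1) e2 psi2 e0.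
have [mg gT] := trig_dense fD g2; have [s [ts gs]] := gT _ dl0.
exists (resid s); split; first exact: resid_trig_observed.
have s2 : wL2 s.
  have gs2 : wL2 (fun x => g x - s x).
    split; first by apply: cmeasurableB => //; exact: cmeasurable_fspan_expij ts.
    exact: lt_trans gs (ltry _).
  by have := wL2B mF mw w0 g2 gs2; apply: eq_wL2 => x _; rewrite opprB addrC subrK.
have gs2 := wL2B mF mw w0 g2 s2.
have := rd _ gs2 gs; rewrite (@eq_wnorm _ _ _ mu freq w _ (fun x => g x - resid s x))//.
move=> x _; rewrite /resid /wresid.
(* As g has zero coefficients, its residual is g itself; hence g - resid s is the residual of g - s,
   small by continuity. *)
have -> : \sum_k winner (fun y => g y - s y) (low_dual k) * low_expij k x =
    - \sum_k winner s (low_dual k) * low_expij k x.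
  by rewrite -sumrN; apply: eq_bigr => k _; rewrite winnerB// g0 sub0r mulNr.
ring.
Qed.

(** * The Gram matrix and the optimal characteristic *)

Variable a : 'cV[R[i]]_N.+1.

Notation B := (BN N f).

(** As [winner] is linear in its first argument, this index order makes B c the vector of products
    of [dual_poly c] with the dual functions. *)
Lemma BN_winner (k j : 'I_N.+1) : B k j = winner (low_dual j) (low_dual k).
Proof. by rewrite mxE winner_dual_expij. Qed.

Definition dual_poly (c : 'cV[R[i]]_N.+1) (x : R) : R[i] :=
  \sum_(j < N.+1) c j 0 * low_dual j x.

Lemma dual_polyE c x : dual_poly c x = trig_poly c x * ((f x)^-1)%:C.
Proof.
by rewrite /trig_poly mulr_suml; apply: eq_bigr => j _; rewrite /low_dual/dual_expij mulrA.
Qed.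

Lemma wL2_dual_poly c : wL2 (dual_poly c).
Proof. by apply: wL2_sum => // j; exact: wL2Z. Qed.

Lemma wL2_trig_poly c : wL2 (@trig_poly R N c).
Proof. by apply: wL2_sum => // j; apply: wL2Z => //; exact: (e2 j). Qed.

Lemma winner_dual_poly c k : winner (dual_poly c) (low_dual k) = (B *m c) k 0.
Proof.
rewrite winner_suml// mxE; apply: eq_bigr => j _.
by rewrite BN_winner mulrC.
Qed.

(** Pairing with the harmonics recovers the coefficients, so a dual polynomial of norm zero has c =
    0; this makes [BN] invertible. *)
Lemma winner_expij_dual_poly c k : winner (dual_poly c) (low_expij k) = c k 0.
Proof.
rewrite winner_suml// (bigD1 k)//= big1 ?addr0 => [|j jk].
  by rewrite (winnerC mF mw w0 (e2 k) (psi2 k)) winner_expij_dual// eqxx rmorph1 mulr1.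
rewrite (winnerC mF mw w0 (e2 k) (psi2 j)) winner_expij_dual//.
have -> : ((k : nat)%:Z == (j : nat)%:Z) = false; last by rewrite rmorph0 mulr0.
by apply/negbTE; apply: contraNneq jk => -[kj]; apply/eqP/val_inj.
Qed.

Lemma winner_trig_poly_dual c k : winner (@trig_poly R N c) (low_dual k) = c k 0.
Proof.
rewrite /trig_poly winner_suml//.
rewrite (bigD1 k)//= big1 ?addr0 => [|j jk].
  by rewrite winner_expij_dual// eqxx mulr1.
rewrite winner_expij_dual//.
have -> : ((j : nat)%:Z == (k : nat)%:Z) = false; last by rewrite mulr0.
by apply/negbTE; apply: contraNneq jk => -[kj]; apply/eqP/val_inj.
Qed.

Lemma wnorm_dual_poly c :
  (fine (wnorm (dual_poly c)))%:C = \sum_(m < N.+1) (c m 0)^* * (B *m c) m 0.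
Proof.
rewrite cintegral_wprod_sum// exchange_big; apply: eq_bigr => m _ /=.
rewrite mxE mulr_sumr; apply: eq_bigr => l _.
by rewrite BN_winner [in RHS](mulrC _ (c l 0)) mulrA [(c m 0)^* * _]mulrC.
Qed.

Lemma BN_unit : B \in unitmx.
Proof.
(* Row freeness concerns left kernels; the transpose turns it into the right kernel of B. *)
rewrite -unitmx_tr -row_free_unit; apply: inj_row_free => v vB.
have Bv : B *m v^T = 0 by rewrite -[B]trmxK -trmx_mul vB trmx0.
have n0 : wnorm (dual_poly v^T) = 0%E.
  rewrite -[LHS]fineK; last exact: (wL2_fin_num w0 (wL2_dual_poly _)).
  congr _%:E; apply: (@complexI R); rewrite wnorm_dual_poly Bv.
  by rewrite big1// => m _; rewrite [X in _ * X]mxE mulr0.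
apply/rowP => k; rewrite mxE; have := winner_expij_dual_poly v^T k; rewrite mxE => <-.
exact: (winner_null mF mw w0 (wL2_dual_poly _)).
Qed.

Notation c := (invmx B *m a).

Lemma BN_solution : B *m c = a.
Proof. by rewrite mulmxA mulmxV ?BN_unit// mul1mx. Qed.

Lemma h_optE x : h_opt a f x = trig_poly a x - dual_poly c x.
Proof. by rewrite /h_opt dual_polyE. Qed.

Lemma wL2_h_opt : wL2 (h_opt a f).
Proof.
apply: (eq_wL2 _ (wL2B mF mw w0 (wL2_trig_poly a) (wL2_dual_poly c))) => x _.
by rewrite h_optE.
Qed.

Lemma L2N_h_opt : L2N N f (h_opt a f).
Proof.
apply: dual0_L2N; first exact: wL2_h_opt.
move=> k; rewrite (@eq_winner _ _ _ mu freq w _ (fun x => trig_poly a x - dual_poly c x)).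
  rewrite winnerB//; [|exact: wL2_trig_poly|exact: wL2_dual_poly].
  by rewrite winner_trig_poly_dual winner_dual_poly BN_solution subrr.
by move=> x _; rewrite h_optE.
Qed.

Lemma DeltaE (g : RM -> R[i]) : wL2 g -> Delta a f g = wnorm (fun x => trig_poly a x - g x).
Proof.
move=> [mg _]; rewrite /Delta sqnorm_fE//; apply: cmeasurableB => //.
by case: (wL2_trig_poly a).
Qed.

Lemma Delta_h_opt : Delta a f (h_opt a f) = wnorm (dual_poly c).
Proof.
rewrite DeltaE; last exact: wL2_h_opt.
by apply: eq_wnorm => x _; rewrite h_optE opprB addrC subrK.
Qed.

(** Stating Pythagoras as an equality yields both optimality and, through the last term,
    uniqueness. *)
Lemma Delta_split (g : RM -> R[i]) : L2N N f g ->
  Delta a f g = (Delta a f (h_opt a f) + wnorm (fun x => h_opt a f x - g x)%R)%E.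
Proof.
move=> gN; have [g2 _] := (L2NP g).1 gN.
have hg2 := wL2B mF mw w0 wL2_h_opt g2.
rewrite DeltaE// Delta_h_opt -wnorm_pythagoras//; last 2 first.
- exact: wL2_dual_poly.
- rewrite winner_suml// big1// => k _.
  rewrite (winnerC mF mw w0 hg2 (psi2 k)) winnerB//; last exact: wL2_h_opt.
  by rewrite !L2N_dual0//; [rewrite subrr rmorph0 mulr0|exact: L2N_h_opt].
by apply: eq_wnorm => x _; rewrite h_optE addrA [dual_poly _ _ + _]addrC subrK.
Qed.

Lemma optimal_h_opt : optimal_characteristic a f (h_opt a f).
Proof.
split; first exact: L2N_h_opt.
by move=> g gN; rewrite (Delta_split gN) leeDl// wnorm_ge0.
Qed.

Lemma optimal_unique (h : RM -> R[i]) : optimal_characteristic a f h ->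
  {ae mu, forall x, freq x -> h x = h_opt a f x}.
Proof.
move=> [hN hopt]; have [h2 _] := (L2NP h).1 hN.
have := hopt _ L2N_h_opt; rewrite (Delta_split hN).
have hh2 := wL2B mF mw w0 wL2_h_opt h2.
have := wL2_fin_num w0 hh2; have := wnorm_ge0 mu w0 (fun x => h_opt a f x - h x).
have := wL2_fin_num w0 (wL2_dual_poly c); rewrite -Delta_h_opt.
(* The minimal error is finite and can be cancelled, which leaves zero for the norm of the
   difference. The weight then drops out where f is nonzero. *)
case: (Delta _ _ _) => // dl _; case E : (wnorm _) => [r| |]//.
rewrite -EFinD !lee_fin gerDl => r0 _ r0'.
have r00 : r = 0 by apply/eqP; rewrite eq_le r0' r0.
rewrite r00 in E.
have FF := @lebesgue_ae_filter R.
apply: filterS2 (wnorm0_ae mF mw w0 hh2.1 E) (density_neq0 fD fM) => x n0 f0 fx.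
have /eqP := n0 fx; rewrite /spec_weight mulf_eq0 [X in _ || X]mulf_eq0.
rewrite (negbTE (f0 fx)) orbF invr_eq0 (gt_eqF (@pi2_gt0 R)) orbF => /eqP /sqnormc0_eq0 /eqP.
by rewrite subr_eq0 => /eqP.
Qed.

Lemma optimal_error :
  (fine (wnorm (dual_poly c)))%:C = inner (invmx B *m a) a.
Proof.
have real_conj (r : R) : (r%:C)^* = r%:C :> R[i].
  by apply: complex_ext; rewrite ?cReC ?cImC /= ?oppr0.
(* The Gram formula gives the sum of conj(c_m) a_m, the conjugate of <c, a>; being a norm it is
   real. *)
rewrite -[LHS]real_conj wnorm_dual_poly BN_solution rmorph_sum.
by apply: eq_bigr => m _; rewrite rmorphM /= conjCK.
Qed.

End interpolation.

(** * Mean square completeness *)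

Section geometric_telescope.
Context {R : realType}.

(* The weights 2 ^ j compensate the factor 2 lost at each use of the
   quasi-triangle inequality for the squared norm. *)
Lemma sqnormc_telescope (z : nat -> R[i]) n p :
  sqnormc (z (n + p)%N - z n) <=
  2 / 2 ^+ n * \sum_(n <= j < n + p) 2 ^+ j * sqnormc (z j.+1 - z j).
Proof.
elim: p n => [|p ih] n.
  by rewrite addn0 subrr sqnormc_real expr0n/= big_geq// mulr0.
rewrite -addSnnS big_ltn; last by rewrite addSn ltnS leq_addr.
rewrite (_ : z _ - z n = (z (n.+1 + p)%N - z n.+1) + (z n.+1 - z n)); last by ring.
apply: le_trans (sqnormcD_le _ _ ltr01) _; rewrite invr1 mulrDr [leRHS]addrC.
have n0 : 2 ^+ n != 0 :> R by rewrite expf_neq0.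
apply: lerD; last by rewrite [leRHS]mulrA divfK.
apply: le_trans (ler_wpM2l _ (ih n.+1)) _; first by rewrite addr_ge0.
by rewrite mulrA le_eqVlt; apply/orP; left; apply/eqP; congr (_ * _); rewrite exprS; field.
Qed.

Lemma cvg_geometric_bound (C : R) : (2 / 2 ^+ n * C) @[n --> \oo] --> (0 : R).
Proof.
have -> : (fun n => 2 / 2 ^+ n * C) = (fun n => (2 * C) * (2^-1 : R) ^+ n).
  by apply/funext => n; rewrite exprVn; ring.
rewrite -(mulr0 (2 * C)); apply: cvgMr; apply: cvg_expr.
by rewrite ger0_norm ?invr_ge0// invf_lt1// ltr1n.
Qed.

Lemma cvg_geometric_cauchy (u : nat -> R) (C : R) :
  (forall n m, (n <= m)%N -> (u m - u n) ^+ 2 <= 2 / 2 ^+ n * C) -> cvgn u.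
Proof.
move=> uC; apply/cauchy_cvgP; apply: cauchy_exP => e e0.
have e20 : 0 < e ^+ 2 by rewrite exprn_gt0.
have /cvgrPdist_lt /(_ _ e20) [n _ nC] := cvg_geometric_bound C.
exists (u n); exists n => // m /= nm; rewrite /ball /=.
rewrite -ltr_sqr ?nnegrE ?(ltW e0)// real_normK ?num_real// -sqrrN opprB.
apply: le_lt_trans (uC n m nm) _; have := nC n (leqnn n).
by rewrite /= sub0r normrN; apply: le_lt_trans; exact: ler_norm.
Qed.

End geometric_telescope.

Section riesz_fischer.
Context d {T : measurableType d} {R : realType}.
Variable mu : {measure set T -> \bar R}.

Notation wt := (fun _ : T => 1 : R).
Notation wL2 := (wL2 mu setT wt).
Notation wnorm := (wnorm mu setT wt).

Variable X : nat -> T -> R[i].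
Hypotheses (X2 : forall n, wL2 (X n))
  (XD : forall n, (wnorm (fun x => X n.+1 x - X n x)%R <= (1 / (2 ^ n.+1)%:R / 2 ^+ n)%:E)%E).

Let m1 : measurable_fun setT wt. Proof. exact: measurable_cst. Qed.
Let w1 x : setT x -> 0 <= wt x. Proof. by []. Qed.

Let dX n x := sqnormc (X n.+1 x - X n x).
(** A pointwise majorant of the oscillation: by [sqnormc_telescope], X n x is a Cauchy sequence
    wherever S x is finite. *)
Let S x : \bar R := (\sum_(k <oo) (2 ^+ k * dX k x)%:E)%E.

Let mX n : cmeasurable_fun setT (X n). Proof. by case: (X2 n). Qed.

Let mdX n : measurable_fun setT (fun x => (2 ^+ n * dX n x)%:E).
Proof.
apply/measurable_EFinP/measurable_funM; first exact: measurable_cst.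
by apply: measurable_sqnormc; exact: cmeasurableB.
Qed.

Let dX0 n x : (0 <= (2 ^+ n * dX n x)%:E)%E.
Proof. by rewrite lee_fin; apply: mulr_ge0; [exact: exprn_ge0|exact: sqnormc_ge0]. Qed.

Let mS : measurable_fun setT S.
Proof. by apply: ge0_emeasurable_sum => // n x _ _; exact: dX0. Qed.

Let S0 x : (0 <= S x)%E.
Proof. by apply: nneseries_ge0 => n _ _; exact: dX0. Qed.

(** In the rate [XD] the factor 2^-n absorbs the weight 2^n of S, and 2^-(n+1) sums to 1. *)
Let intS : (\int[mu]_x S x <= 1)%E.
Proof.
rewrite integral_nneseries//.
apply: (@le_trans _ _ (\sum_(k <oo) (1 / (2 ^ k.+1)%:R)%:E)%E); last exact: epsilon_trick0.
apply: lee_nneseries => [n _ _|n _].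
  by apply: integral_ge0 => x _; exact: dX0.
have e0 : 0 <= 2 ^+ n :> R by rewrite exprn_ge0.
have -> : (\int[mu]_x (2 ^+ n * dX n x)%:E = (2 ^+ n)%:E * wnorm (fun x => X n.+1 x - X n x)%R)%E.
  rewrite /wnorm -ge0_integralZl_EFin//.
  - by apply: eq_integral => x _; rewrite mulr1 EFinM.
  - by move=> x _; rewrite lee_fin mulr1 sqnormc_ge0.
  - by apply: measurable_wnorm_integrand => //; exact: cmeasurableB.
apply: le_trans (lee_wpmul2l _ (XD n)) _; first by rewrite lee_fin.
by rewrite -EFinM lee_fin mulrC divfK// expf_neq0.
Qed.

(** The upper limit is measurable without removing an exceptional set, and equals the limit wherever
    S is finite. *)
Let Y x : R[i] := fine (limn_esup (fun n => (complex.Re (X n x))%:E)) +i*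
  fine (limn_esup (fun n => (complex.Im (X n x))%:E)).

Let mY : cmeasurable_fun setT Y.
Proof.
split; apply: (measurableT_comp (fine_measurable measurableT));
  apply: measurable_fun_limn_esup => n; apply/measurable_EFinP;
  by case: (mX n).
Qed.

Let partS x n m : S x \is a fin_num -> (n <= m)%N ->
  sqnormc (X m x - X n x) <= 2 / 2 ^+ n * fine (S x).
Proof.
move=> Sfin nm; rewrite -(subnKC nm).
apply: le_trans (sqnormc_telescope (fun k => X k x) n (m - n)) _.
have nn : 0 <= 2 / 2 ^+ n :> R by rewrite divr_ge0// exprn_ge0.
rewrite ler_wpM2l// -lee_fin fineK// -sumEFin.
apply: le_trans (@nneseries_lim_ge R (fun k => (2 ^+ k * dX k x)%:E) xpredT 0 m _).
  rewrite subnKC// [leRHS](@big_cat_nat _ _ _ n)//= leeDr//.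
  by apply: sume_ge0 => k _; exact: dX0.
by move=> k _ _; exact: dX0.
Qed.

Let Y_bound x n : S x \is a fin_num ->
  sqnormc (Y x - X n x) <= 2 / 2 ^+ n * fine (S x).
Proof.
move=> Sfin.
have part (pr : R[i] -> R) : (forall z, pr z ^+ 2 <= sqnormc z) ->
    (forall z u, pr (z - u) = pr z - pr u) ->
    pr (X k x) @[k --> \oo] --> fine (limn_esup (fun n => (pr (X n x))%:E)).
  move=> prs prB; have /cvg_ex [/= l cl] : cvgn (fun k => pr (X k x)).
    apply: (@cvg_geometric_cauchy _ _ (fine (S x))) => p m pm.
    by rewrite -prB; apply: le_trans (prs _) (partS Sfin pm).
  have cle : (pr (X k x))%:E @[k --> \oo] --> l%:E.
    by apply: cvg_EFin => //; exact: nearW.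
  by rewrite (cvg_limn_einf_sup cle).2.
have cRe := part (@complex.Re R) _ _; have cIm := part (@complex.Im R) _ _.
have {}cRe : complex.Re (X k x) @[k --> \oo] --> complex.Re (Y x).
  apply: cRe => z; first by rewrite sqnormcE lerDl sqr_ge0.
  by move=> u; rewrite cReD cReN.
have {}cIm : complex.Im (X k x) @[k --> \oo] --> complex.Im (Y x).
  apply: cIm => z; first by rewrite sqnormcE lerDr sqr_ge0.
  by move=> u; rewrite cImD cImN.
have cs : sqnormc (X k x - X n x) @[k --> \oo] --> sqnormc (Y x - X n x).
  have -> : (fun k => sqnormc (X k x - X n x)) = (fun k =>
      (complex.Re (X k x) - complex.Re (X n x)) * (complex.Re (X k x) - complex.Re (X n x)) +
      (complex.Im (X k x) - complex.Im (X n x)) * (complex.Im (X k x) - complex.Im (X n x))).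
    by apply/funext => k; rewrite sqnormcE cReD cReN cImD cImN !expr2.
  rewrite sqnormcE cReD cReN cImD cImN !expr2.
  have cR : complex.Re (X k x) - complex.Re (X n x) @[k --> \oo] -->
      complex.Re (Y x) - complex.Re (X n x).
    by apply: cvgB => //; exact: cvg_cst.
  have cI : complex.Im (X k x) - complex.Im (X n x) @[k --> \oo] -->
      complex.Im (Y x) - complex.Im (X n x).
    by apply: cvgB => //; exact: cvg_cst.
  by apply: cvgD; [exact: (cvgM cR cR)|exact: (cvgM cI cI)].
rewrite -(cvg_lim (@Rhausdorff R) cs); apply: limr_le.
  by apply/cvg_ex; eexists; exact: cs.
by exists n => // m /= nm; exact: partS.
Qed.

(** [Y_bound] is integrated: it holds where S is finite, hence almost everywhere, and the integral
    of S is at most 1. *)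
Lemma riesz_fischer_geometric : exists2 Y, wL2 Y &
  forall n, (wnorm (fun x => Y x - X n x)%R <= (2 / 2 ^+ n)%:E)%E.
Proof.
have YX n : (wnorm (fun x => Y x - X n x)%R <= (2 / 2 ^+ n)%:E)%E.
  have nn : 0 <= 2 / 2 ^+ n :> R by rewrite divr_ge0// exprn_ge0.
  apply: (@le_trans _ _ (\int[mu]_x ((2 / 2 ^+ n)%:E * S x))%E); last first.
    by rewrite ge0_integralZl_EFin// -[leRHS]mule1 lee_wpmul2l// intS.
  apply: ae_ge0_le_integral => //.
  - by move=> x _; rewrite lee_fin mulr1 sqnormc_ge0.
  - by apply: measurable_wnorm_integrand => //; exact: cmeasurableB.
  - by move=> x _; rewrite mule_ge0.
  - exact: measurable_funeM.
  have iS : mu.-integrable setT S.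
    apply/integrableP; split=> //.
    rewrite (eq_integral S); first exact: le_lt_trans intS (ltry _).
    by move=> x _; rewrite gee0_abs.
  apply: filterS (integrable_ae measurableT iS) => x /(_ I) Sfin _.
  rewrite mulr1 -[S x]fineK// -EFinM lee_fin.
  exact: Y_bound.
exists Y => //.
have y2 : wL2 (fun x => Y x - X 0%N x).
  by split; [exact: cmeasurableB|exact: le_lt_trans (YX 0%N) (ltry _)].
by apply: eq_wL2 (wL2D measurableT m1 w1 y2 (X2 0%N)) => x _; rewrite subrK.
Qed.

End riesz_fischer.

(** * The stochastic integral *)

(** Formally e -> 0 and then t -> 0. The right side is (1 + t)^2 G + K e, where K depends on t
    alone, so t is fixed before e. *)
Lemma le_of_quasi_triangle (R : realType) (G H : R) : 0 <= G ->
  (forall t e : R, 0 < t -> 0 < e ->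
     H <= (1 + t) * ((1 + t) * G + (1 + t^-1) * e) + (1 + t^-1) * e) -> H <= G.
Proof.
move=> G0 GH; apply/ler_addgt0Pr => eta eta0.
have G1 : 0 < 6 * (G + 1) by rewrite mulr_gt0// ltr_wpDl.
(* As t <= 1, (1 + t)^2 G - G <= 3 t G <= eta / 2; the other half is K e with e = eta / (2 K). *)
pose t := Num.min 1 (eta / (6 * (G + 1))).
have t0 : 0 < t by rewrite lt_min ltr01 divr_gt0.
have t1 : t <= 1 by rewrite ge_min lexx.
have tG : t * (6 * (G + 1)) <= eta by rewrite -ler_pdivlMr// ge_min lexx orbT.
have t10 : 0 < t^-1 by rewrite invr_gt0.
pose K := (1 + t) * (1 + t^-1) + (1 + t^-1).
have K0 : 0 < K by rewrite addr_gt0// ?mulr_gt0// addr_gt0.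
have e0 : 0 < eta / (2 * K) by rewrite divr_gt0// mulr_gt0.
apply: le_trans (GH t _ t0 e0) _.
have -> : (1 + t) * ((1 + t) * G + (1 + t^-1) * (eta / (2 * K))) +
    (1 + t^-1) * (eta / (2 * K)) = (1 + t) ^+ 2 * G + K * (eta / (2 * K)).
  by rewrite /K; ring.
have -> : K * (eta / (2 * K)) = eta / 2 by field; rewrite gt_eqF.
have t2G : t ^+ 2 * G <= t * G by rewrite ler_wpM2r// expr2 ler_piMl// ltW.
have tG0 : 0 <= t * G by rewrite mulr_ge0// ltW.
have -> : (1 + t) ^+ 2 * G = G + 2 * (t * G) + t ^+ 2 * G by ring.
lra.
Qed.

Section stochastic_integral.
Context d {T : measurableType d} {R : realType}.
Variables (P : probability T R) (f : R -> R) (Z : set R -> T -> R[i]).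
Notation mu := (@lebesgue_measure R).
Notation RM := (measurableTypeR R).
Notation freq := (@freq R : set RM).
Hypotheses (fD : is_density f) (ZO : orthogonal_stochastic_measure P f Z).

Notation w := (spec_weight f).
Notation wt := (fun _ : T => 1 : R).
Notation fL2 := (wL2 mu freq w).
Notation fnorm := (wnorm mu freq w).
Notation PL2 := (wL2 P setT wt).
Notation Pnorm := (wnorm P setT wt).

Let mF := @measurable_freq R.
Let mw := measurable_spec_weight fD.
Let w0 := spec_weight_ge0 fD.
Let m1 : measurable_fun setT wt. Proof. exact: measurable_cst. Qed.
Let w1 x : setT x -> 0 <= wt x. Proof. by []. Qed.

Lemma mean_squareE X : mean_square P X = Pnorm X.
Proof. by rewrite /mean_square unlock; apply: eq_integral => x _; rewrite mulr1. Qed.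

Lemma square_integrableE X : square_integrable P X <-> PL2 X.
Proof. by rewrite /square_integrable mean_squareE. Qed.

(* A simple function together with its stochastic integral, as one function on
   the disjoint union of the spectral domain and the probability space. *)
Definition joint (A : set R) (y : R + T) : R[i] :=
  match y with inl x => (\1_A x)%:C | inr v => Z A v end.

Definition adm (A : set R) : Prop := measurable (A : set RM) /\ A `<=` @Defs.freq R.

Definition joint_simple : set (R + T -> R[i]) := fspan joint adm.

Let Z2 A : adm A -> PL2 (Z A).
Proof. by case: ZO => Zs _ _ [mA AF]; apply/square_integrableE; exact: Zs. Qed.

Let ind2 A : adm A -> fL2 (fun x => (\1_A x)%:C).
Proof.
move=> [mA _]; apply: (@wL2_bounded _ _ fD _ 1).
  by apply: cmeasurable_real; exact: measurable_indic.
by move=> x _; rewrite sqnormc_real indicE; case: (x \in A); rewrite /= ?expr1n ?expr0n.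
Qed.

Let Z_inner A B : adm A -> adm B ->
  cintegral P setT (fun v => Z A v * (Z B v)^* * (wt v)%:C) =
  cintegral mu freq (fun x => (\1_A x)%:C * ((\1_B x)%:C)^* * (w x)%:C).
Proof.
move=> [mA AF] [mB BF]; case: ZO => _ _ /(_ A B mA AF mB BF) ZAB.
transitivity (cexpectation P (fun v => Z A v * (Z B v)^*)).
  by apply: eq_cintegral => v _; rewrite mulr1.
rewrite ZAB /spec_integral -cintegralZ; last 2 first.
- exact: mF.
- apply: (@cintegrable_le _ _ _ mu freq mF _ f).
  + apply: cmeasurable_real; apply: measurable_funM; last exact: density_measurable.
    by apply: measurable_indic; exact: measurableI.
  + exact: fD.2.
  + move=> x fx; rewrite sqnormc_real exprMn ler_piMl ?sqr_ge0//.
apply: eq_cintegral => x _; rewrite /spec_weight.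
have -> : (\1_(A `&` B) x : R) = \1_A x * \1_B x by rewrite indicI.
rewrite !real_cM.
have -> : ((\1_B x)%:C)^* = (\1_B x)%:C :> R[i].
  by apply: complex_ext; rewrite ?cReC ?cImC /= ?oppr0.
ring.
Qed.

(** Both norms expand over Gram matrices, which agree by [Z_inner]; the sets may therefore
    overlap. *)
Lemma joint_simpleL2 s : joint_simple s ->
  [/\ fL2 (fun x => s (inl x)), PL2 (fun v => s (inr v)) &
      Pnorm (fun v => s (inr v)) = fnorm (fun x => s (inl x))].
Proof.
move=> [n [c [A [mA sE]]]].
have E1 : (fun x => s (inl x)) = (fun x => \sum_(l < n) c l * (\1_(A l) x)%:C).
  by apply/funext => x; rewrite sE.
have E2 : (fun v => s (inr v)) = (fun v => \sum_(l < n) c l * Z (A l) v).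
  by apply/funext => x; rewrite sE.
have i2 l := ind2 (mA l); have z2 l := Z2 (mA l).
have s1 : fL2 (fun x => \sum_(l < n) c l * (\1_(A l) x)%:C).
  by apply: wL2_sum => // l; exact: wL2Z.
have s2 : PL2 (fun v => \sum_(l < n) c l * Z (A l) v).
  by apply: wL2_sum => // l; exact: wL2Z.
rewrite E1 E2; split=> //.
rewrite -[LHS]fineK; last exact: wL2_fin_num s2.
rewrite -[RHS]fineK; last exact: wL2_fin_num s1.
congr _%:E; apply: (@complexI R).
rewrite (cintegral_wprod_sum _ m1)// (cintegral_wprod_sum mF mw)//.
by apply: eq_bigr => l _; apply: eq_bigr => m _; rewrite Z_inner.
Qed.

Lemma is_stochastic_integralP (g : RM -> R[i]) Y :
  is_stochastic_integral P f Z g Y <->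
  [/\ fL2 g, PL2 Y & forall e : R, 0 < e -> exists s, [/\ joint_simple s,
    (fnorm (fun x => g x - s (inl x))%R < e%:E)%E &
    (Pnorm (fun v => Y v - s (inr v))%R < e%:E)%E]].
Proof.
split=> -[].
  move=> /(L2E fD) g2 /square_integrableE Y2 gY; split=> // e /gY [n [c [A [mA gA YA]]]].
  pose s y := \sum_(l < n) c l * joint (A l) y.
  have ss : joint_simple s by exists n, c, A.
  have [s1 _ _] := joint_simpleL2 ss.
  exists s; split=> //; last by rewrite -mean_squareE.
  by rewrite -sqnorm_fE//; apply: cmeasurableB; [case: g2|case: s1].
move=> g2 Y2 gY; split; [exact/(L2E fD)|exact/square_integrableE|].
move=> e /gY [s [ss gs Ys]]; have [s1 _ _] := joint_simpleL2 ss.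
have [n [c [A [mA sE]]]] := ss; exists n, c, A; split=> //.
  have -> : (fun x => g x - \sum_(l < n) c l * (\1_(A l) x)%:C) =
      (fun x => g x - s (inl x)) by apply/funext => x; rewrite sE.
  by rewrite sqnorm_fE//; apply: cmeasurableB; [case: g2|case: s1].
have -> : (fun v => Y v - \sum_(l < n) c l * Z (A l) v) =
    (fun v => Y v - s (inr v)) by apply/funext => x; rewrite sE.
by rewrite mean_squareE.
Qed.

Lemma wnorm_perturb d' (T' : measurableType d') (nu : {measure set T' -> \bar R})
    (D : set T') (v : T' -> R) (mD : measurable D) (mv : measurable_fun D v)
    (v0 : forall x, D x -> 0 <= v x) g u (t e : R) :
  wL2 nu D v g -> wL2 nu D v u -> 0 < t ->
  (wnorm nu D v (fun x => g x - u x)%R < e%:E)%E ->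
  fine (wnorm nu D v g) <= (1 + t) * fine (wnorm nu D v u) + (1 + t^-1) * e.
Proof.
move=> g2 u2 t0 gu; have gu2 := wL2B mD mv v0 g2 u2.
rewrite -lee_fin EFinD !EFinM !fineK; [|exact: wL2_fin_num u2|exact: wL2_fin_num g2].
rewrite (@eq_wnorm _ _ _ nu D v g (fun x => u x + (g x - u x))); last first.
  by move=> x _; ring.
apply: le_trans (wnormD_le nu mD mv v0 t0 u2.1 gu2.1) _.
apply: leeD => //; apply: lee_wpmul2l; last exact: ltW.
by rewrite lee_fin addr_ge0// invr_ge0 ltW.
Qed.

(** A common simple function links Y to g by two quasi-triangle steps, in either direction, with t
    and e arbitrary. *)
Lemma stochastic_integral_isometry (g : RM -> R[i]) Y :
  is_stochastic_integral P f Z g Y -> Pnorm Y = fnorm g.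
Proof.
move=> /is_stochastic_integralP [g2 Y2 gY].
rewrite -[LHS]fineK; last exact: wL2_fin_num Y2.
rewrite -[RHS]fineK; last exact: wL2_fin_num g2.
congr _%:E; apply/eqP; rewrite eq_le.
have G0 : 0 <= fine (fnorm g) by rewrite fine_ge0// wnorm_ge0.
have H0 : 0 <= fine (Pnorm Y) by rewrite fine_ge0// wnorm_ge0.
have tt (t : R) : 0 < t -> 0 <= 1 + t by move=> t0; rewrite addr_ge0// ltW.
apply/andP; split; apply: le_of_quasi_triangle => // t e t0 e0;
  have [s [ss gs Ys]] := gY _ e0; have [s1 s2 s12] := joint_simpleL2 ss.
- apply: le_trans (wnorm_perturb measurableT m1 w1 Y2 s2 t0 Ys) _.
  rewrite lerD2r ler_wpM2l ?tt// s12.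
  by rewrite wnormB_sym in gs; exact: (wnorm_perturb mF mw w0 s1 g2 t0 gs).
- apply: le_trans (wnorm_perturb mF mw w0 g2 s1 t0 gs) _.
  rewrite lerD2r ler_wpM2l ?tt// -s12.
  by rewrite wnormB_sym in Ys; exact: (wnorm_perturb measurableT m1 w1 s2 Y2 t0 Ys).
Qed.

Lemma stochastic_integral_lin c (g g' : RM -> R[i]) Y Y' :
  is_stochastic_integral P f Z g Y -> is_stochastic_integral P f Z g' Y' ->
  is_stochastic_integral P f Z (fun x => c * g x + g' x) (fun v => c * Y v + Y' v).
Proof.
move=> /is_stochastic_integralP [g2 Y2 gY] /is_stochastic_integralP [g2' Y2' gY'].
apply/is_stochastic_integralP; split.
- exact: (wL2D mF mw w0 (wL2Z mF mw w0 c g2) g2').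
- exact: (wL2D measurableT m1 w1 (wL2Z measurableT m1 w1 c Y2) Y2').
move=> e e0; have e4 : 0 < e / 4 by rewrite divr_gt0.
have c1 : 0 < sqnormc c + 1 by rewrite ltr_wpDl ?sqnormc_ge0.
have [s [ss gs Ys]] := gY _ (divr_gt0 e4 c1).
have [s' [ss' gs' Ys']] := gY' _ e4.
exists (fun y => c * s y + s' y); split; first exact: fspan_lin.
- have [s1 _ _] := joint_simpleL2 ss; have [s1' _ _] := joint_simpleL2 ss'.
  have d2 := wL2B mF mw w0 g2 s1; have d2' := wL2B mF mw w0 g2' s1'.
  exact: (wnorm_lin_lt mF mw w0 e0 d2.1 d2'.1 gs gs').
- have [_ s1 _] := joint_simpleL2 ss; have [_ s1' _] := joint_simpleL2 ss'.
  have d2 := wL2B measurableT m1 w1 Y2 s1; have d2' := wL2B measurableT m1 w1 Y2' s1'.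
  exact: (wnorm_lin_lt measurableT m1 w1 e0 d2.1 d2'.1 Ys Ys').
Qed.

Lemma stochastic_integral_sum n (c : 'I_n -> R[i]) (g : 'I_n -> RM -> R[i])
    (Y : 'I_n -> T -> R[i]) :
  (forall l, is_stochastic_integral P f Z (g l) (Y l)) ->
  is_stochastic_integral P f Z (fun x => \sum_(l < n) c l * g l x)
    (fun v => \sum_(l < n) c l * Y l v).
Proof.
move=> gY; elim: (index_enum _) => [|l r ih].
  have -> : (fun x : RM => \sum_(l <- [::]) c l * g l x) = (fun=> 0).
    by apply/funext => x; rewrite big_nil.
  have -> : (fun v => \sum_(l <- [::]) c l * Y l v) = (fun=> 0).
    by apply/funext => x; rewrite big_nil.
  apply/is_stochastic_integralP; split; [exact: wL2_0|exact: wL2_0|].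
  move=> e e0; exists (fun=> 0); split; first exact: fspan0.
    by rewrite /wnorm integral0_eq// => x _; rewrite subrr sqnormc_real expr0n mul0r.
  by rewrite /wnorm integral0_eq// => x _; rewrite subrr sqnormc_real expr0n mul0r.
have := stochastic_integral_lin (c l) (gY l) ih.
have -> : (fun x : RM => \sum_(i <- l :: r) c i * g i x) =
    (fun x => c l * g l x + \sum_(i <- r) c i * g i x).
  by apply/funext => x; rewrite big_cons.
have -> // : (fun v => \sum_(i <- l :: r) c i * Y i v) =
    (fun v => c l * Y l v + \sum_(i <- r) c i * Y i v).
by apply/funext => x; rewrite big_cons.
Qed.

(** The spectral shadow of [joint_simple]: density is proved here, and the witness s retains the
    matching random variable. *)
Let simple_part : set (RM -> R[i]) :=
  [set u | exists2 s, joint_simple s & u = (fun x => s (inl x))].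

Let simple_dense g : fL2 g -> wclos mu freq w simple_part g.
Proof.
have msp u : simple_part u -> cmeasurable_fun freq u.
  by move=> [s ss ->]; have [[]] := joint_simpleL2 ss.
apply: (wclos_wL2 mF mw w0 msp).
  move=> c _ _ [s ss ->] [s' ss' ->].
  by exists (fun y => c * s y + s' y); first exact: fspan_lin.
move=> A mA AF; apply: sub_wclos => //.
exists (joint A) => //; apply: fspan_gen; by split.
Qed.

Lemma stochastic_integral_exists (g : RM -> R[i]) : fL2 g ->
  exists Y, is_stochastic_integral P f Z g Y.
Proof.
move=> g2; have [mg gS] := simple_dense g2.
(* Chosen so that 2 (dl n + dl n) = 2^-(n+1) 2^-n, the rate required by
   [riesz_fischer_geometric]. *)
pose dl n : R := (8 * 4 ^+ n)^-1.
have dl0 n : 0 < dl n by rewrite invr_gt0 mulr_gt0// exprn_gt0.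
have /choice [s s_] n : exists s, joint_simple s /\
    (fnorm (fun x => g x - s (inl x))%R < (dl n)%:E)%E.
  by have [_ [[s ss ->] gs]] := gS _ (dl0 n); exists s.
have ss n := (s_ n).1; have gs n := (s_ n).2.
have s1 n : fL2 (fun x => s n (inl x)) by have [] := joint_simpleL2 (ss n).
have X2 n : PL2 (fun v => s n (inr v)) by have [] := joint_simpleL2 (ss n).
have dlS n : dl n.+1 <= dl n.
  rewrite lef_pV2 ?posrE ?mulr_gt0 ?exprn_gt0// ler_pM2l// ler_eXn2l ?ltr1n//.
have XD n : (Pnorm (fun v => s n.+1 (inr v) - s n (inr v))%R <=
    (1 / (2 ^ n.+1)%:R / 2 ^+ n)%:E)%E.
  (* The difference is again a joint simple function, so its norm over P can be computed on the
     spectral side. *)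
  have sd : joint_simple (fun y => -1 * s n y + s n.+1 y).
    exact: (fspan_lin (-1) (ss n) (ss n.+1)).
  have [_ _] := joint_simpleL2 sd.
  rewrite (@eq_wnorm _ _ _ P setT wt _ (fun v => s n.+1 (inr v) - s n (inr v))); last first.
    by move=> v _; ring.
  move=> ->; rewrite (@eq_wnorm _ _ _ mu freq w _ (fun x => (g x - s n (inl x)) +
    (s n.+1 (inl x) - g x))); last by move=> x _; ring.
  have a2 := wL2B mF mw w0 g2 (s1 n); have b2 := wL2B mF mw w0 (s1 n.+1) g2.
  apply: le_trans (wnormD_le2 mu mF mw w0 a2.1 b2.1) _.
  rewrite [X in (_ + X)%E]wnormB_sym.
  apply: (@le_trans _ _ (2%:E * ((dl n)%:E + (dl n)%:E))%E).
    rewrite lee_wpmul2l// leeD ?ltW//; apply: lt_le_trans (gs n.+1) _.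
    by rewrite lee_fin.
  rewrite -EFinD -EFinM lee_fin le_eqVlt; apply/orP; left; apply/eqP.
  have n0 : 2 ^+ n != 0 :> R by rewrite expf_neq0.
  rewrite /dl natrX exprS (_ : (4 : R) = 2 * 2); last by ring.
  by rewrite exprMn; field.
have [Y Y2 YX] := riesz_fischer_geometric X2 XD.
exists Y; apply/is_stochastic_integralP; split=> // e e0.
have C0 : (2 / 2 ^+ n * 1 : R) @[n --> \oo] --> (0 : R) by exact: cvg_geometric_bound.
have /cvgrPdist_lt /(_ _ e0) [n _ nC] := C0.
(* One n serves both sides, since dl n <= 2 / 2^n. *)
have ne : 2 / 2 ^+ n < e.
  have := nC n (leqnn n); rewrite /= mulr1 sub0r normrN.
  by apply: le_lt_trans; exact: ler_norm.
exists (s n); split=> //.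
- apply: lt_trans (gs n) _; rewrite lte_fin; apply: le_lt_trans ne.
  have n0 : 0 < 2 ^+ n :> R by rewrite exprn_gt0.
  rewrite /dl (_ : (4 : R) = 2 * 2); last by ring.
  rewrite exprMn -div1r ler_pdivrMr ?mulr_gt0//.
  have -> : 2 / 2 ^+ n * (8 * (2 ^+ n * 2 ^+ n)) = 16 * 2 ^+ n :> R.
    by field; rewrite gt_eqF.
  have : 1 <= 2 ^+ n :> R by apply: exprn_ege1; rewrite ler1n.
  lra.
- by apply: le_lt_trans (YX n) _; rewrite lte_fin.
Qed.

End stochastic_integral.
Theorem theorem6p1 (R : realType) (d : measure_display) (T : measurableType d)
    (P : probability T R) (xi : int -> T -> R[i]) (f : R -> R)
    (Z : set R -> T -> R[i]) (N : nat) (a : 'cV[R[i]]_N.+1)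
    (xi_stationary : wide_sense_stationary P xi)
    (xi_density : has_spectral_density P xi f)
    (f_minimal : minimal f)
    (Z_orthogonal : orthogonal_stochastic_measure P f Z)
    (xi_spectral :
       forall j : int, is_stochastic_integral P f Z (expij j) (xi j)) :
  [/\ BN N f \in unitmx,
      optimal_characteristic a f (h_opt a f),
      forall h, optimal_characteristic a f h ->
        {ae @lebesgue_measure R, forall x, @freq R x -> h x = h_opt a f x} &
      exists2 err : R, err%:C = inner (invmx (BN N f) *m a) a &
        [/\ Delta a f (h_opt a f) = err%:E,
            exists Ahat : T -> R[i],
              is_stochastic_integral P f Z (h_opt a f) Ahat &
            forall Ahat : T -> R[i],
              is_stochastic_integral P f Z (h_opt a f) Ahat ->
              mean_square P (fun w => linear_functional a xi w - Ahat w)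
              = err%:E]].
Proof.
have fD : is_density f by case: xi_density.
have wA := wL2_h_opt fD f_minimal a.
have wD := wL2_dual_poly fD f_minimal (invmx (BN N f) *m a).
have mw := measurable_spec_weight fD; have w0 := spec_weight_ge0 fD.
have DE : Delta a f (h_opt a f) = (fine (wnorm lebesgue_measure (@freq R)
    (spec_weight f) (dual_poly f (invmx (BN N f) *m a))))%:E.
  by rewrite Delta_h_opt// fineK//; exact: wL2_fin_num wD.
split.
- exact: BN_unit.
- exact: optimal_h_opt.
- by move=> h; exact: optimal_unique.
- exists (fine (wnorm lebesgue_measure (@freq R) (spec_weight f)
    (dual_poly f (invmx (BN N f) *m a)))).
    exact: optimal_error.
  split; first exact: DE.
    exact: stochastic_integral_exists.
  move=> Ahat Ah; rewrite -DE DeltaE// mean_squareE.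
  (* The functional is the stochastic integral of [trig_poly a], so the estimation error is that of
     [trig_poly a - h_opt a f], and the isometry applies. *)
  have Lin := stochastic_integral_sum fD Z_orthogonal (fun j : 'I_N.+1 => a j 0)
    (fun j : 'I_N.+1 => xi_spectral (j : nat)%:Z).
  have := stochastic_integral_lin fD Z_orthogonal (-1) Ah Lin.
  move=> /(stochastic_integral_isometry fD Z_orthogonal) E.
  rewrite (@eq_wnorm _ _ _ P setT _ _
    (fun v => -1 * Ahat v + \sum_(j < N.+1) a j 0 * xi (j : nat)%:Z v)); last first.
    by move=> v _; rewrite mulN1r addrC.
  by rewrite E; apply: eq_wnorm => x _; rewrite mulN1r addrC.
Qed.
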